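(* For Lebesgue-almost every triangle $\Delta$ (in the space of triangles up to similarity, parametrized by two of its angles $(\alpha,\beta)$ ranging over $\{\alpha>0,\beta>0,\alpha+\beta<\pi\}$ with Lebesgue measure) the following holds: for every $\epsilon>0$ there is a constant $C>0$ such that for all $n\ge 1$, $$P_n(\Delta)<C\,e^{n^{\sqrt{3}-1+\epsilon}}.$$
   Context: Consider the billiard in a triangle $\Delta$. A generalized diagonal is a billiard orbit segment that starts at a vertex of $\Delta$ and ends at a vertex of $\Delta$ (reflecting elastically off the sides in between). Its length is the number of reflections it makes. $P_n(\Delta)$ denotes the total number of generalized diagonals of $\Delta$ of length at most $n$. This number depends only on the similarity class of $\Delta$. *)

(* Defs.v *)
From HB Require Import structures.
From mathcomp Require Import all_boot all_order all_algebra.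
From mathcomp Require Import all_classical all_reals all_analysis.
Set Implicit Arguments. Unset Strict Implicit. Unset Printing Implicit Defensive.
Import Order.TTheory GRing.Theory Num.Theory.
Local Open Scope ring_scope.

Section Billiard.
Variable R : realType.
Implicit Types (a b : R) (P Q X u v d : R * R).

Definition padd P Q : R * R := (P.1 + Q.1, P.2 + Q.2).
Definition psub P Q : R * R := (P.1 - Q.1, P.2 - Q.2).
Definition pscale (t : R) P : R * R := (t * P.1, t * P.2).
Definition pdot P Q : R := P.1 * Q.1 + P.2 * Q.2.

(* The triangle with angles a (at vA), b (at vB), pi - a - b (at vC),
   normalised (similarity class) so that vA = (0,0), vB = (1,0);
   |vA vC| = sin b / sin (a + b) by the law of sines. *)
Definition vA : R * R := (0, 0).
Definition vB : R * R := (1, 0).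
Definition vC a b : R * R :=
  let t := sin b / sin (a + b) in (t * cos a, t * sin a).
Definition vertices a b : seq (R * R) := [:: vA; vB; vC a b].
Definition sides a b : seq ((R * R) * (R * R)) :=
  [:: (vA, vB); (vB, vC a b); (vC a b, vA)].

Definition on_open_seg P Q X : Prop :=
  exists t : R, 0 < t /\ t < 1 /\ X = padd P (pscale t (psub Q P)).
Definition on_closed_seg P Q X : Prop :=
  exists t : R, 0 <= t /\ t <= 1 /\ X = padd P (pscale t (psub Q P)).

Definition reflect_dir d u : R * R :=
  psub (pscale (2 * pdot u d / pdot d d) d) u.

Definition reflects_at a b W X Y : Prop :=
  exists P Q, (P, Q) \in sides a b /\ on_open_seg P Q X /\
    exists l : R, 0 < l /\ psub Y X = pscale l (reflect_dir (psub Q P) (psub X W)).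

(* A generalized diagonal, given as the sequence of its points
   p_0, p_1, ..., p_{k+1}: p_0 and p_{k+1} are vertices, p_1..p_k are the
   reflection points (interior points of sides, obeying the reflection law),
   and no segment [p_i, p_{i+1}] runs along a side (so its relative interior
   lies in the interior of the triangle). Its length is k = size - 2. *)
Definition gen_diag a b (s : seq (R * R)) : Prop :=
  (2 <= size s)%N /\
  head vA s \in vertices a b /\
  last vA s \in vertices a b /\
  (forall i, (0 < i)%N -> (i.+1 < size s)%N ->
     reflects_at a b (nth vA s i.-1) (nth vA s i) (nth vA s i.+1)) /\
  (forall i, (i.+1 < size s)%N ->
     ~ (exists P Q, (P, Q) \in sides a b /\
          on_closed_seg P Q (nth vA s i) /\ on_closed_seg P Q (nth vA s i.+1))).

Definition diag_length (s : seq (R * R)) : nat := (size s - 2)%N.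

End Billiard.

(* Main.v *)
(* Unfold a generalized diagonal starting at a vertex into a straight ray crossing a strip of
   reflected triangles; it is determined by its starting vertex and by the word of the sides it
   crosses.  Take diagonals of length l <= m^3 whose initial directions agree up to
   96^(-41 m^2), and let a common prefix of their words branch during the next m crossings.
   Two rays that are neighbours in angle branch at a vertex of the strip.  If the middle one of
   three consecutive branching vertices were crossed last, it would be the farthest one along
   the rays, so the three would be almost aligned without being aligned.  But the area they
   span is, up to a unimodular factor, an integer polynomial of degree O(m) in e^(2ia) and
   e^(2ib), given by a word of length m.  There are only exp(O(m)) such words, and a polynomial
   with leading coefficient at least 1 in modulus is smaller than exp(-c m^2) only within
   exp(-c' m) of one of its roots.  By Borel-Cantelli and Fubini, for almost every (a, b) and
   every large m the area is therefore either 0 or at least exp(-O(m^2)).  Hence the branching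
   times have no local maximum, a block of m crossings has at most 2m + 1 continuations, and
   the number of diagonals of length at most m^3 is exp(O(m^2 log m)).  With n = m^3 this is
   exp(n^(2/3 + o(1))), and 2/3 < sqrt 3 - 1. *)
Require Import Defs.
From HB Require Import structures.
From mathcomp Require Import all_boot all_order all_algebra.
From mathcomp Require Import all_classical all_reals all_analysis.
From mathcomp Require Import measurable_realfun complex ring lra zify.
Set Implicit Arguments. Unset Strict Implicit. Unset Printing Implicit Defensive.
Import Order.TTheory GRing.Theory Num.Theory.
Import numFieldNormedType.Exports.


(** * Counting and first differences *)

(** Counting through duplicate-free lists, as the theorem does, bounds a cardinality without first
    knowing that the set is finite. *)
Definition at_most (T : eqType) (P : T -> Prop) (K : nat) : Prop :=
  forall s : seq T, uniq s -> (forall x, x \in s -> P x) -> (size s <= K)%N.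

Lemma at_most_sub (T : eqType) (P Q : T -> Prop) K :
  (forall x, P x -> Q x) -> at_most Q K -> at_most P K.
Proof. by move=> PQ bQ s us sP; apply: bQ => // x /sP /PQ. Qed.

Lemma at_most_leq (T : eqType) (P : T -> Prop) K K' :
  (K <= K')%N -> at_most P K -> at_most P K'.
Proof. by move=> le bP s us sP; apply: leq_trans le; apply: bP. Qed.

Lemma at_most_seq (T : eqType) (P : T -> Prop) (r : seq T) :
  (forall x, P x -> x \in r) -> at_most P (size r).
Proof. by move=> Pr s us sP; apply: uniq_leq_size => // x /sP /Pr. Qed.

Lemma at_most1 (T : eqType) (P : T -> Prop) :
  (forall x y, P x -> P y -> x = y) -> at_most P 1.
Proof.
move=> Pu [|x [|y s]] //= us sP.
have exy : x = y by apply: Pu; apply: sP; rewrite !inE eqxx ?orbT.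
by move: us; rewrite exy inE eqxx.
Qed.

Lemma at_most_fibers (T U : eqType) (g : T -> U) (P : T -> Prop) K K' :
  at_most (fun y => exists2 x, P x & g x = y) K ->
  (forall y, at_most (fun x => P x /\ g x = y) K') ->
  at_most P (K * K').
Proof.
move=> bK bK' s us sP.
have le_ys (ys : seq U) : (size [seq x <- s | g x \in ys] <= size ys * K')%N.
  elim: ys => [|y ys IH] /=.
    by rewrite (eq_filter (a2 := pred0)) ?filter_pred0 // => x; rewrite inE.
  rewrite mulSn size_filter.
  have -> : count (fun x => g x \in y :: ys) s =
            count (predU (fun x => g x == y) (fun x => g x \in ys)) s.
    by apply: eq_count => x; rewrite /= inE.
  have := count_predUI (fun x => g x == y) (fun x => g x \in ys) s.
  move=> /(f_equal (fun k => k - count (predI (fun x => g x == y)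
     (fun x => g x \in ys)) s)); rewrite addnK => ->.
  apply: leq_trans (leq_subr _ _) _; rewrite -!size_filter leq_add //.
  apply: (bK' y); first exact: filter_uniq.
  by move=> x; rewrite mem_filter => /andP[/eqP <- /sP].
have := le_ys (undup (map g s)).
have -> : [seq x <- s | g x \in undup (map g s)] = s.
  by apply/all_filterP/allP => x xs; rewrite mem_undup map_f.
move/leq_trans; apply; rewrite leq_mul2r; apply/orP; right.
apply: bK; first exact: undup_uniq.
by move=> y; rewrite mem_undup => /mapP[x /sP Px ->]; exists x.
Qed.

Lemma first_difference (T : eqType) (d : T) (y y' : seq T) :
  size y = size y' -> y != y' ->
  exists t, [/\ (t < size y)%N, take t y = take t y' & nth d y t != nth d y' t].
Proof.
elim: y y' => [|a y IH] [|a' y'] //= [sz].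
have [->|ne] := eqVneq a a'; last by exists 0; rewrite !take0.
rewrite eqseq_cons eqxx /= => /(IH _ sz)[t [lt e ne]].
by exists t.+1; rewrite /= e.
Qed.

(** Once a step does not descend, all later steps ascend strictly. So the sequence first falls
    strictly and then, after at most one flat step, rises strictly; each of the two stretches takes
    distinct values among m. *)
Lemma no_peak_length (t : nat -> nat) j m M :
  (forall i, (i < M)%N -> (j <= t i < j + m)%N) ->
  (forall i, (i.+2 < M)%N -> (t i <= t i.+1)%N -> (t i.+1 < t i.+2)%N) ->
  (M <= m.*2)%N.
Proof.
move=> bt np.
have inc k i : (i.+1 + k < M)%N -> (t i <= t i.+1)%N ->
    (t i.+1 + k <= t (i.+1 + k))%N /\ (t (i + k) <= t (i + k).+1)%N.
  elim: k => [|k IH] lt le; first by rewrite !addn0.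
  have [||a b] := IH => //; first lia.
  have h := np (i + k) _ b.
  have {}h : (t (i + k).+1 < t (i + k).+2)%N by apply: h; lia.
  rewrite !addnS; split; last by apply: ltnW.
  move: a h; rewrite !addSn; lia.
(* Either every step up to [i] descends, or the sequence falls until some earlier [i'] whose next
   step does not descend. *)
have dec i : (i < M)%N ->
    (t i + i <= t 0)%N \/ exists2 i', (i' < i)%N & (t i' + i' <= t 0)%N /\ (t i' <= t i'.+1)%N.
  elim: i => [|i IH] lt; first by left; rewrite addn0.
  have [|h|[i' lti' h]] := IH; first lia.
    have [le|gt] := leqP (t i) (t i.+1); last by left; lia.
    by right; exists i.
  by right; exists i' => //; lia.
case: M => [//|M] in bt np inc dec *.
have b0 := bt 0 isT; have bM := bt M (ltnSn M).
have [//|h|[i lti [h1 h2]]] := dec M; first lia.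
have bi := bt i ltac:(lia).
have [||h3 _] := inc (M - i.+1) i => //; first lia.
move: h3; rewrite subnKC //; have := bt i.+1 ltac:(lia); lia.
Qed.

Local Open Scope ring_scope.

(** * Triangles crossed by nearly parallel rays *)

Section Geometry.
Variable R : realFieldType.
Implicit Types (P Q I J X Y Z K : R * R) (x p : R).

(** Twice the signed area of the triangle P Q X. *)
Definition det3 P Q X : R :=
  (Q.1 - P.1) * (X.2 - P.2) - (Q.2 - P.2) * (X.1 - P.1).

Definition between P Q X : Prop :=
  exists c, [/\ 0 < c, c < 1,
    X.1 = (1 - c) * P.1 + c * Q.1 & X.2 = (1 - c) * P.2 + c * Q.2].

(** Height of P above the line of slope x through the origin; its sign tells on which side of the
    ray P lies. *)
Definition offset x P : R := P.2 - x * P.1.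

Lemma between_offset x p I J : between I J (p, x * p) ->
  exists c, [/\ 0 < c, c < 1 & (1 - c) * offset x I + c * offset x J = 0].
Proof.
move=> [c [c0 c1 /= e1 e2]]; exists c; split=> //.
rewrite /offset; have -> : (1 - c) * (I.2 - x * I.1) + c * (J.2 - x * J.1) =
 ((1 - c) * I.2 + c * J.2) - x * ((1 - c) * I.1 + c * J.1) by ring.
by rewrite -e1 -e2 subrr.
Qed.

Lemma between_opposite x p I J : between I J (p, x * p) ->
  offset x I != 0 -> offset x I * offset x J < 0.
Proof.
move=> /between_offset[c [c0 c1 e]] nz.
have h : offset x I ^+ 2 > 0 by rewrite exprn_even_gt0.
have : c * (offset x I * offset x J) = - ((1 - c) * offset x I ^+ 2).
  have -> : offset x I ^+ 2 = offset x I * offset x I by [].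
  have -> : c * (offset x I * offset x J) = offset x I * (c * offset x J) by ring.
  have -> : c * offset x J = - ((1 - c) * offset x I) by lra.
  ring.
move=> h2; rewrite -(pmulr_rlt0 _ c0) h2 oppr_lt0 mulr_gt0 //; lra.
Qed.

Section Edge.
Variables (I J X K : R * R) (x p p' e : R).
Hypothesis D2 : det3 I J X ^+ 2 = 1.
Hypothesis IJ : between I J (p, x * p).
Hypothesis XK : between X K (p', x * p').
Hypothesis KIJ : K = I \/ K = J.

(** [det3 I J] vanishes where the ray meets I J, at parameter p, and varies along the ray at the
    rate [nu]. *)
Let nu := (J.1 - I.1) * x - (J.2 - I.2).

Let det_ray s : det3 I J (s, x * s) = nu * (s - p).
Proof.
case: IJ => c [_ _ /= e1 e2].
have f1 : p - I.1 = c * (J.1 - I.1) by rewrite {1}e1; ring.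
have f2 : x * p - I.2 = c * (J.2 - I.2) by rewrite {1}e2; ring.
transitivity ((J.1 - I.1) * (x * p - I.2) - (J.2 - I.2) * (p - I.1) + nu * (s - p)).
  by rewrite /nu /det3 /=; ring.
by rewrite f1 f2; ring.
Qed.

Let nuX : nu * (X.1 - p) = det3 I J X - (J.1 - I.1) * offset x X.
Proof. by rewrite -det_ray /det3 /offset /=; ring. Qed.

Let nuI : nu * (I.1 - p) = - ((J.1 - I.1) * offset x I).
Proof. by rewrite -det_ray /det3 /offset /=; ring. Qed.

(** The ray meets X K at p', and K is an end of I J, so this point lies on the same side of I J as
    X. *)
Let nu_far : 0 < det3 I J X * nu * (p' - p).
Proof.
have e1 := det_ray p'; rewrite -mulrA -e1.
case: XK => c [c0 c1 /= f1 f2].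
have -> : det3 I J (p', x * p') = (1 - c) * det3 I J X.
  by rewrite /det3 /= f2 f1; case: KIJ => ->; ring.
rewrite mulrCA -expr2 D2; lra.
Qed.

(** The triangle I J X has doubled area 1. An offset of X too small to outweigh this area leaves the
    abscissa of X on the same side of p as p'. *)
Lemma exit_before : p' < p -> `|(J.1 - I.1) * offset x X| < 1 -> X.1 < p.
Proof.
move=> lt sm; have nf := nu_far.
have s : det3 I J X * nu < 0 by rewrite -(nmulr_lgt0 _ (x := p' - p)) //; lra.
have h : 0 < det3 I J X * nu * (X.1 - p).
  rewrite -mulrA nuX mulrBr -expr2 D2 subr_gt0.
  have := ler_norm (det3 I J X * ((J.1 - I.1) * offset x X)).
  rewrite normrM (_ : `|det3 I J X| = 1) ?mul1r; first by move/le_lt_trans; apply.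
  by apply/eqP; rewrite -(@eqrXn2 _ 2) // ?normr_ge0 // real_normK ?num_real // D2 expr1n.
by have := h; rewrite nmulr_rgt0 // subr_lt0.
Qed.

(** The same comparison when the ray enters through I J. For the second claim the offsets of X and
    of I each take away at most 1/4 of the doubled area 1. *)
Lemma entry_after : p < p' -> 4 * `|(J.1 - I.1) * offset x X| <= 1 ->
  p < X.1 /\ (4 * `|(J.1 - I.1) * offset x I| <= 1 -> I.1 < X.1).
Proof.
move=> lt sX; have nf := nu_far.
have s : 0 < det3 I J X * nu by rewrite -(pmulr_lgt0 _ (x := p' - p)) //; lra.
have n1 : `|det3 I J X| = 1.
  by apply/eqP; rewrite -(@eqrXn2 _ 2) // ?normr_ge0 // real_normK ?num_real // D2 expr1n.
have hX := ler_norm (det3 I J X * ((J.1 - I.1) * offset x X)).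
rewrite normrM n1 mul1r in hX.
have h1 : det3 I J X * nu * (X.1 - p) = 1 - det3 I J X * ((J.1 - I.1) * offset x X).
  by rewrite -mulrA nuX mulrBr -expr2 D2.
split=> [|sI]; first by rewrite -subr_gt0 -(pmulr_rgt0 _ s) h1; lra.
have hI := ler_norm (- (det3 I J X * ((J.1 - I.1) * offset x I))).
rewrite normrN normrM n1 mul1r in hI.
have h2 : det3 I J X * nu * (I.1 - p) = - (det3 I J X * ((J.1 - I.1) * offset x I)).
  by rewrite -mulrA nuI mulrN.
rewrite -subr_gt0 -(pmulr_rgt0 _ s).
have -> : X.1 - I.1 = (X.1 - p) - (I.1 - p) by ring.
rewrite mulrBr h1 h2; lra.
Qed.

End Edge.

Lemma offset_slopes P x x' : x < x' -> 0 < P.1 -> offset x P * offset x' P < 0 ->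
  x * P.1 < P.2 /\ P.2 < x' * P.1.
Proof.
move=> ly u0; rewrite /offset /= => h.
have d : 0 < (x' - x) * P.1 by rewrite mulr_gt0 // subr_gt0.
split; rewrite ltNge; apply/negP => h'; move: h; apply/negP; rewrite -leNgt.
  by apply: mulr_le0; lra.
by apply: mulr_ge0; lra.
Qed.

(** The slopes of X, Y and Z lie in successive intervals, hence increase. As Y is also farther out
    than the other two, it lies strictly beyond the line X Z as seen from the origin. *)
Lemma middle_not_farthest X Y Z x0 x1 x2 x3 :
  x0 < x1 -> x1 < x2 -> x2 < x3 ->
  0 < X.1 -> 0 < Z.1 -> X.1 < Y.1 -> Z.1 < Y.1 ->
  offset x0 X * offset x1 X < 0 -> offset x1 Y * offset x2 Y < 0 ->
  offset x2 Z * offset x3 Z < 0 -> 0 < det3 X Y Z.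
Proof.
case: X Y Z => [a a'] [b b'] [c c'] l01 l12 l23 /= a0 c0 ab cb.
move=> /(offset_slopes (P := (a, a')) l01 a0) /= [A1 A2] /(offset_slopes (P := (b, b')) l12 (lt_trans a0 ab)) /= [B1 B2].
move=> /(offset_slopes (P := (c, c')) l23 c0) /= [C1 C2]; rewrite /det3 /=.
have h1 : 0 < (x1 * a - a') * (b - c) by apply: mulr_gt0; lra.
have h2 : 0 < (c' - x2 * c) * (b - a) by apply: mulr_gt0; lra.
have h3 : 0 < (x2 - x1) * (c * (b - a)) by rewrite !mulr_gt0 //; lra.
have h4 : 0 < (x2 - x1) * (a * (b - c)) by rewrite !mulr_gt0 //; lra.
(* In the determinant [b'] is multiplied by [a - c], whose sign decides which of the bounds
   [x1 * b < b' < x2 * b] is of use. *)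
have [le|le] := leP c a.
  have h5 : 0 <= (b' - x1 * b) * (a - c) by apply: mulr_ge0; lra.
  lra.
have h5 : 0 <= (x2 * b - b') * (c - a) by apply: mulr_ge0; lra.
lra.
Qed.

End Geometry.

(** * Strips of unfolded triangles and the vertices where words branch *)

Section Strip.
Variable R : realFieldType.
Implicit Types (P Q I J X Y Z K : R * R) (x : R) (p : nat -> R) (w : seq (option bool)).

Lemma third_vertex (i j : option bool) : i != j ->
  exists k, [/\ k != i, k != j & forall l, [|| l == i, l == j | l == k]].
Proof.
case: i => [[]|]; case: j => [[]|] // _;
 by [exists None; split=> //; case=> [[]|] | exists (Some true); split=> //; case=> [[]|]
    | exists (Some false); split=> //; case=> [[]|]].
Qed.

(* [V u i] is the vertex i of the triangle reached after crossing the sides opposite to the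
   letters of u, in coordinates where the starting vertex is the origin and a ray of
   direction parameter x is {(p, x p) : 0 < p}. *)
Variable V : seq (option bool) -> option bool -> R * R.
Variable st : option bool.
Hypothesis V_step : forall u o i, i != o -> V (rcons u o) i = V u i.
Hypothesis V_base : forall i, i != st -> V [::] i = (1, 0) \/ V [::] i = (1, 1).

Let Vt w t := V (take t w).
Let wt w t := nth None w t.

(** For positive t this is the new vertex of triangle t, opposite to the side just crossed. Both
    sides through which a ray can leave end there, so rays part at this vertex. *)
Definition apex w t := V (take t w) (nth None w t.-1).

(** A ray from a vertex first crosses the opposite side, hence the condition on letter 0. [p t] is
    the parameter at which side number t is crossed. *)
Definition ray w x p : Prop :=
  [/\ 0 < x /\ x < 1, wt w 0 = st,
      forall t, (t.+1 < size w)%N -> wt w t != wt w t.+1,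
      forall t, (t < size w)%N -> 0 < p t /\ ((t.+1 < size w)%N -> p t < p t.+1) &
      forall t i j, (t < size w)%N -> i != j -> i != wt w t -> j != wt w t ->
        between (Vt w t i) (Vt w t j) (p t, x * p t)].

Lemma Vt_step w t i : (t < size w)%N -> i != wt w t -> Vt w t.+1 i = Vt w t i.
Proof. by move=> lt ne; rewrite /Vt (take_nth None) // V_step. Qed.

Lemma take_eq_nth w w' t s : take t w = take t w' -> (s < t)%N -> wt w s = wt w' s.
Proof. by move=> e lt; rewrite /wt -(nth_take None lt) e nth_take. Qed.

Lemma take_leq_eq w w' t s : take t w = take t w' -> (s <= t)%N -> take s w = take s w'.
Proof. by move=> e lt; rewrite -(take_takel w lt) e take_takel. Qed.

Lemma mul_balanced (g h a b c c' : R) : 0 < c -> c < 1 -> 0 < c' -> c' < 1 ->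
  (1 - c) * g + c * a = 0 -> (1 - c') * h + c' * b = 0 -> 0 < g * h -> 0 < a * b.
Proof.
move=> c0 c1 d0 d1 e f gh.
have e' : c * a = - ((1 - c) * g) by lra.
have f' : c' * b = - ((1 - c') * h) by lra.
have : 0 < (c * a) * (c' * b).
  rewrite e' f' mulrNN mulrACA mulr_gt0 // mulr_gt0 //; lra.
by rewrite mulrACA pmulr_rgt0 // mulr_gt0.
Qed.

(* The side on which a ray leaves each vertex of the strip is a function of the word
   crossed so far. *)
Lemma common_side w w' x x' p p' t i : ray w x p -> ray w' x' p' ->
  (t < size w)%N -> (t < size w')%N -> take t.+1 w = take t.+1 w' -> i != wt w t ->
  0 < offset x (Vt w t i) * offset x' (Vt w t i).
Proof.
move=> [[x0 x1] w0 dw pw bw] [[x0' x1'] w0' dw' pw' bw'].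
elim: t i => [|t IH] i lt lt' et ne; last have lt1 := ltnW lt; last have lt1' := ltnW lt'.
  rewrite w0 in ne; rewrite /Vt take0 /offset.
  by case: (V_base ne) => -> /=; rewrite ?mulr1 ?add0r ?sub0r ?mulrNN mulr_gt0 ?subr_gt0.
have et1 : take t.+1 w = take t.+1 w' by apply: take_leq_eq et _.
have [ei|ni] := eqVneq i (wt w t); last first.
  by rewrite Vt_step //; apply: IH.
have ew : wt w t.+1 = wt w' t.+1 by apply: take_eq_nth et _.
have ewt : wt w t = wt w' t by apply: take_eq_nth et1 _.
have [k [k1 k2 _]] := third_vertex ne.
have [c [c0 c1 e]] := between_offset (bw t.+1 k i lt k1 k2 ne).
have eV : Vt w' t.+1 = Vt w t.+1 by rewrite /Vt et1.
have [c' [c0' c1' e']] : exists c, [/\ 0 < c, c < 1 &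
    (1 - c) * offset x' (Vt w t.+1 k) + c * offset x' (Vt w t.+1 i) = 0].
  by rewrite -eV; apply: between_offset (bw' t.+1 k i lt' k1 _ _); rewrite -?ew.
apply: mul_balanced e e' _ => //.
by rewrite ei in k1; rewrite Vt_step //; apply: IH.
Qed.

Lemma side_neq0 w x p t i : ray w x p -> (t < size w)%N -> i != wt w t ->
  offset x (Vt w t i) != 0.
Proof.
move=> rw lt ne; have := common_side rw rw lt lt erefl ne.
by apply: contraTneq => ->; rewrite mulr0 ltxx.
Qed.

(** Both rays enter through the same side, and [common_side] says that they separate its endpoints
    in the same way. They leave through the two different sides at the apex, so the apex lies
    opposite to one endpoint for the first ray and opposite to the other for the second. *)
Lemma apex_split w w' x x' p p' t : ray w x p -> ray w' x' p' ->
  (0 < t)%N -> (t < size w)%N -> (t < size w')%N ->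
  take t w = take t w' -> wt w t != wt w' t ->
  offset x (apex w t) * offset x' (apex w t) < 0.
Proof.
case: t => [//|t] rw rw' _ lt lt' et ne; rewrite /apex /=.
have := rw; have := rw'.
move=> [_ w0' dw' pw' bw'] [_ w0 dw pw bw].
have ewt : wt w t = wt w' t by apply: take_eq_nth et _.
have eV : Vt w' t.+1 = Vt w t.+1 by rewrite /Vt et.
set o := nth None w t; set i := wt w t.+1; set j := wt w' t.+1.
have oi : o != i by apply: dw.
have oj : o != j by rewrite /o -/(wt w t) ewt; apply: dw'.
have b1 := bw t.+1 j o lt; rewrite (eq_sym j) -/i (eq_sym j) in b1.
have {b1}b1 := b1 oj ne oi.
have b2 := bw' t.+1 i o lt'; rewrite (eq_sym i) eV -/j in b2.
have {b2}b2 := b2 oi ne oj.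
have lt1 : (t < size w)%N by lia. have lt1' : (t < size w')%N by lia.
have io : i != wt w t by rewrite eq_sym. have jo : j != wt w t by rewrite eq_sym.
have cs := common_side rw rw' lt1 lt1' et io.
have csj := common_side rw rw' lt1 lt1' et jo.
rewrite -!(Vt_step lt1) // in cs csj.
have h := side_neq0 rw lt1 io; have hj := side_neq0 rw' lt1' (i := j).
rewrite -ewt in hj; have {}hj := hj jo.
rewrite -(Vt_step lt1) // in h.
have bb := bw t i j lt1 ne io jo; rewrite -!(Vt_step lt1) // in bb.
have o1 := between_opposite bb h.
have nj : offset x (Vt w t.+1 j) != 0 by apply: contraTneq o1 => ->; rewrite mulr0 ltxx.
have o2 := between_opposite b1 nj.
have ni : offset x' (Vt w t.+1 i) != 0 by apply: contraTneq cs => ->; rewrite mulr0 ltxx.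
have o3 := between_opposite b2 ni.
move: cs csj o1 o2 o3; rewrite -/(Vt w t.+1).
set a := offset x _; set a' := offset x' _; set b := offset x _; set b' := offset x' _.
set u := offset x _; set u' := offset x' _ => aa bb' ab bu au.
(* Only signs matter now: [a], [b], [u] are the offsets of the two endpoints and of the apex from
   the first ray, the primed letters those from the second. *)
have : 0 < (a * b) * (b * u) by rewrite -mulrNN mulr_gt0 ?oppr_gt0.
have -> : a * b * (b * u) = b ^+ 2 * (a * u) by rewrite expr2; ring.
have bsq : 0 < b ^+ 2 by rewrite exprn_even_gt0.
rewrite pmulr_rgt0 // => au0.
have a2 : 0 < (a * a') * (a * u) by rewrite mulr_gt0.
have a3 : 0 < (a * a') * (a * u) * - (a' * u') by rewrite mulr_gt0 // oppr_gt0.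
have e3 : (a * a') * (a * u) * - (a' * u') = (a * a') ^+ 2 * - (u * u') by rewrite expr2; ring.
by move: a3; rewrite e3 pmulr_rgt0 ?oppr_gt0 // exprn_even_gt0 //= gt_eqF.
Qed.

Section Near.
Variables (w : seq (option bool)) (x : R) (p : nat -> R) (B e : R).
Hypothesis rw : ray w x p.
Hypothesis det1 : forall t i j k, (t <= size w)%N -> i != j -> i != k -> j != k ->
  det3 (Vt w t i) (Vt w t j) (Vt w t k) ^+ 2 = 1.
Hypothesis bndB : forall t i, (t <= size w)%N -> `|(Vt w t i).1| <= B.
Hypothesis Be : 8 * (B * e) <= 1.

Let near X := `|offset x X| <= e.

Let small t i j X : (t <= size w)%N -> near X ->
  4 * `|((Vt w t i).1 - (Vt w t j).1) * offset x X| <= 1.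
Proof.
move=> lt nX; apply: le_trans Be; rewrite normrM.
have h : `|(Vt w t i).1 - (Vt w t j).1| <= 2 * B.
  apply: le_trans (ler_normB _ _) _.
  have := bndB i lt; have := bndB j lt; lra.
have -> : 8 * (B * e) = 4 * ((2 * B) * e) by ring.
by rewrite ler_wpM2l // ler_pM.
Qed.

(** Induction on the crossings: X remains an endpoint of the crossed side until the side opposite to
    it is crossed, and at that moment [exit_before] puts it behind the crossing. *)
Let behind s t X : (0 < s)%N -> (s < t)%N -> (t <= size w)%N -> near X ->
  X = apex w s ->
  (exists2 i, i != wt w t.-1 & X = Vt w t i) \/ X.1 < p t.-1.
Proof.
move=> s0 st' lt nX eX.
have [_ w0 dw pw bw] := rw.
elim: t st' lt => [//|t IH] st' lt.
have [es|nes] := eqVneq s t.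
  have ns : wt w s.-1 != wt w s by have := dw s.-1; rewrite prednK // => h; apply: h; rewrite es.
  rewrite -es in lt *; left.
  by exists (wt w s.-1) => //; rewrite eX Vt_step.
have {nes}st1 : (s < t)%N by lia.
have lt' : (t <= size w)%N by lia.
have [t1 et] : exists t1, t = t1.+1 by exists t.-1; lia.
subst t; have {IH}[[i /= ni eXi]|/= lX] := IH st1 lt'; last first.
  right; apply: lt_trans lX _; apply: (pw t1 _).2; lia.
have [ei|nei] := eqVneq i (wt w t1.+1); last first.
  by left; exists i => //=; rewrite Vt_step.
right => /=.
have [k [k1 k2 _]] := third_vertex ni.
set o := wt w t1 in ni k1 k2 *.
have lt1 : (t1 < size w)%N by lia.
have ok : o != k by rewrite eq_sym.
have d1 := dw t1 lt.
have bIJ := bw t1.+1 o k lt ok d1; rewrite -ei in bIJ; have {}bIJ := bIJ k1.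
have bXK := bw t1 i k lt1; rewrite eq_sym in bXK; have {}bXK := bXK k1 ni k2.
rewrite -!(Vt_step lt1) // -eXi in bXK.
apply: (exit_before (p' := p t1) _ bIJ bXK); [|by right|exact: (pw t1 lt1).2|].
  by rewrite eXi; apply: det1 => //; rewrite eq_sym.
apply: le_lt_trans (_ : 4^-1 < 1); last by lra.
have := small k o lt' nX; lra.
Qed.

(** The apex lies ahead of the last crossing. An earlier near vertex is either behind that crossing
    or still an endpoint of the crossed side, where [entry_after] compares it with the apex. *)
Lemma apex_forward t : (0 < t)%N -> (t < size w)%N -> near (apex w t) -> 0 < (apex w t).1 /\
  (forall s, (0 < s)%N -> (s < t)%N -> near (apex w s) -> (apex w s).1 < (apex w t).1).
Proof.
case: t => [//|t] _ lt nY.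
have [_ w0 dw pw bw] := rw.
have lt1 : (t < size w)%N by lia. have lt2 : (t.+1 <= size w)%N by lia.
set o := wt w t.
have oo : o != wt w t.+1 by apply: dw.
have key i : i != o -> p t < (apex w t.+1).1 /\
   (near (Vt w t.+1 i) -> (Vt w t.+1 i).1 < (apex w t.+1).1).
  move=> ni; have [k [k1 k2 kk]] := third_vertex ni.
  have ik : i != k by rewrite eq_sym.
  have bIJ := bw t i k lt1 ik ni k2.
  rewrite -!(Vt_step lt1) // in bIJ.
  (* the exit edge joins the apex to one of the endpoints of the entry edge *)
  have [l lne [bl lik]] : exists2 l, l != wt w t.+1 &
      between (apex w t.+1) (Vt w t.+1 l) (p t.+1, x * p t.+1) /\ (l = i \/ l = k).
    have [ei|nei] := eqVneq i (wt w t.+1).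
      exists k; first by rewrite -ei.
      split; last by right.
      by apply: bw => //; rewrite -?ei // eq_sym.
    exists i => //; split; last by left.
    by apply: bw => //; rewrite eq_sym.
  have D : det3 (Vt w t.+1 i) (Vt w t.+1 k) (apex w t.+1) ^+ 2 = 1 by apply: det1.
  have KIJ : Vt w t.+1 l = Vt w t.+1 i \/ Vt w t.+1 l = Vt w t.+1 k.
    by case: lik => ->; [left|right].
  have pt := (pw t lt1).2 lt.
  have D' : det3 (Vt w t.+1 k) (Vt w t.+1 i) (apex w t.+1) ^+ 2 = 1.
    by apply: det1 => //.
  have sY := small k i lt2 nY.
  have [e1 e2] := entry_after D bIJ bl KIJ pt sY.
  by split=> // nI; apply/e2/small.
have [i ni] : exists i, i != o by case: (o) => [[]|]; [exists None|exists None|exists (Some true)].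
split=> [|s s0 st' nX]; first by apply: lt_trans (pw t lt1).1 (key i ni).1.
have [[i' /= ni' eX]|/= lX] := behind s0 st' lt2 nX erefl.
  by rewrite eX; apply: (key i' ni').2; rewrite -eX.
by apply: lt_trans lX (key i ni).1.
Qed.
End Near.

(** * Windows of m crossings, for directions within [delta] and an area gap [eta] *)

Section Window.
Variables (B delta eta : R).
Hypothesis delta_small : 16 * (B ^+ 2 * delta) < eta.
Hypothesis eta1 : eta <= 1.

Definition tame w : Prop := forall t, (t <= size w)%N ->
  (forall i, `|(Vt w t i).1| <= B) /\
  (forall i j k, i != j -> i != k -> j != k ->
     det3 (Vt w t i) (Vt w t j) (Vt w t k) ^+ 2 = 1).

(** The two offsets have opposite signs, so each is at most their difference in modulus. *)
Lemma offset_le_diff x x' P : offset x P * offset x' P < 0 ->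
  `|offset x' P| <= `|P.1| * `|x - x'|.
Proof.
move=> neg; rewrite -normrM.
have -> : P.1 * (x - x') = offset x' P - offset x P by rewrite /offset; ring.
move: neg; set a := offset x P; set b := offset x' P => neg.
have [b0|b0|->] := ltgtP b 0; last by rewrite normr0.
  have a0 : 0 < a by rewrite -(nmulr_llt0 _ b0).
  by rewrite !ltr0_norm; lra.
have a0 : a < 0 by rewrite -(pmulr_llt0 _ b0).
by rewrite !gtr0_norm; lra.
Qed.

Lemma apex_eq w w' t : (0 < t)%N -> take t w = take t w' -> apex w t = apex w' t.
Proof.
move=> t0 e; rewrite /apex e; congr (V _ _).
by apply: take_eq_nth e _; rewrite ltn_predL.
Qed.

(* If the middle vertex were crossed last it would be farthest along the nearly
   parallel rays, so the three vertices would be almost but not exactly aligned. *)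
Lemma no_peak w0 w1 w2 w3 x0 x1 x2 x3 p0 p1 p2 p3 t0 t1 t2 :
  ray w0 x0 p0 -> ray w1 x1 p1 -> ray w2 x2 p2 -> ray w3 x3 p3 ->
  x0 < x1 -> x1 < x2 -> x2 < x3 -> x3 - x0 <= delta -> tame w1 ->
  [/\ (0 < t0)%N, (t0 < size w0)%N, (t0 < size w1)%N, take t0 w0 = take t0 w1 & wt w0 t0 != wt w1 t0] ->
  [/\ (0 < t1)%N, (t1 < size w1)%N, (t1 < size w2)%N, take t1 w1 = take t1 w2 & wt w1 t1 != wt w2 t1] ->
  [/\ (0 < t2)%N, (t2 < size w2)%N, (t2 < size w3)%N, take t2 w2 = take t2 w3 & wt w2 t2 != wt w3 t2] ->
  (det3 (apex w1 t0) (apex w1 t1) (apex w1 t2) = 0 \/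
    eta <= `|det3 (apex w1 t0) (apex w1 t1) (apex w1 t2)|) ->
  (t0 <= t1)%N -> (t1 < t2)%N.
Proof.
move=> r0 r1 r2 r3 l01 l12 l23 dl tm [t0p s00 s01 e01 n01] [t1p s11 s12 e12 n12]
  [t2p s22 s23 e23 n23] good le01; rewrite ltnNge; apply/negP => le21.
have cX := apex_split r0 r1 t0p s00 s01 e01 n01.
have cY := apex_split r1 r2 t1p s11 s12 e12 n12.
have cZ := apex_split r2 r3 t2p s22 s23 e23 n23.
rewrite (apex_eq t0p e01) in cX.
rewrite -(apex_eq t2p (take_leq_eq e12 le21)) in cZ.
have s21 : (t2 < size w1)%N by apply: leq_ltn_trans le21 s11.
have B0 : 0 <= B by apply: le_trans (normr_ge0 _) ((tm 0%N isT).1 None).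
have bnd t : (t < size w1)%N -> `|(apex w1 t).1| <= B by move=> h; apply: (tm t (ltnW h)).1.
have bm t u v d : (t < size w1)%N -> offset u (apex w1 t) * offset v (apex w1 t) < 0 ->
   `|u - v| <= d -> `|offset v (apex w1 t)| <= B * d.
  move=> h /offset_le_diff le ld; apply: le_trans le _.
  by apply: ler_pM => //; apply: bnd.
have d0 : 0 < delta by lra.
(* The factor 2 makes one bound serve all three vertices: Z separates x2 from x3, and passing from
   x2 to x1 costs another [B * delta]. *)
have nX : `|offset x1 (apex w1 t0)| <= B * (2 * delta).
  by apply: bm cX _ => //; rewrite ltr0_norm; lra.
have nY : `|offset x1 (apex w1 t1)| <= B * (2 * delta).
  by rewrite mulrC in cY; apply: bm cY _ => //; rewrite gtr0_norm; lra.
have nZ : `|offset x1 (apex w1 t2)| <= B * (2 * delta).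
  have -> : offset x1 (apex w1 t2) = offset x2 (apex w1 t2) + (apex w1 t2).1 * (x2 - x1).
    by rewrite /offset; ring.
  apply: le_trans (ler_normD _ _) _; rewrite mulrDl mul1r mulrDr lerD //.
    by rewrite mulrC in cZ; apply: bm cZ _ => //; rewrite gtr0_norm; lra.
  by rewrite normrM ler_pM ?bnd // gtr0_norm; lra.
have Be : 8 * (B * (B * (2 * delta))) <= 1.
  have -> : 8 * (B * (B * (2 * delta))) = 16 * (B ^+ 2 * delta) by rewrite expr2; ring.
  exact: le_trans (ltW delta_small) eta1.
have fwd t := apex_forward r1 (fun t i j k h => (tm t h).2 i j k) (fun t i h => (tm t h).1 i) Be (t := t).
have [Y0 fY] := fwd t1 t1p s11 nY.
have [X0 _] := fwd t0 t0p s01 nX.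
have [Z0 _] := fwd t2 t2p s21 nZ.
have XY : (apex w1 t0).1 < (apex w1 t1).1.
  have [e|ne] := eqVneq t0 t1; last by apply: fY => //; rewrite ltn_neqAle ne.
  have [_] := offset_slopes l01 X0 cX; rewrite e.
  by have [/ltW] := offset_slopes l12 Y0 cY; rewrite leNgt => /negP.
have ZY : (apex w1 t2).1 < (apex w1 t1).1.
  have [e|ne] := eqVneq t2 t1; last by apply: fY => //; rewrite ltn_neqAle ne.
  have [] := offset_slopes l23 Z0 cZ; rewrite e.
  by have [_ /ltW] := offset_slopes l12 Y0 cY; rewrite leNgt => /negP.
have D0 := middle_not_farthest l01 l12 l23 X0 Z0 XY ZY cX cY cZ.
case: good => [e|]; first by rewrite e ltxx in D0.
apply/negP; rewrite -ltNge; apply: le_lt_trans delta_small.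
move: (bnd _ s01) (bnd _ s11) (bnd _ s21) nX nY nZ.
set X := apex w1 t0; set Y := apex w1 t1; set Z := apex w1 t2 => bX bY bZ nX nY nZ.
(* A shear turns ordinates into offsets without changing the area; as all offsets are small, the
   area falls below [eta]. *)
have -> : det3 X Y Z = (Y.1 - X.1) * (offset x1 Z - offset x1 X)
    - (offset x1 Y - offset x1 X) * (Z.1 - X.1) by rewrite /det3 /offset; ring.
apply: le_trans (ler_normB _ _) _; rewrite !normrM.
have h2 (a b c : R) : `|a| <= c -> `|b| <= c -> `|a - b| <= 2 * c.
  by move=> ha hb; apply: le_trans (ler_normB _ _) _; lra.
have -> : 16 * (B ^+ 2 * delta) = (2 * B) * (2 * (B * (2 * delta))) + (2 * (B * (2 * delta))) * (2 * B).
  by rewrite expr2; ring.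
by rewrite lerD // ler_pM // h2.
Qed.

Section Count.
Variables (T : eqType) (w : T -> seq (option bool)) (x : T -> R) (p : T -> nat -> R).
Variables (D : T -> Prop) (l j m : nat).
Hypothesis D_ray : forall d, D d -> ray (w d) (x d) (p d) /\ size (w d) = l.
Hypothesis D_tame : forall d, D d -> tame (w d).
Hypothesis D_close : forall d d', D d -> D d' ->
  take j (w d) = take j (w d') /\ `|x d - x d'| <= delta.
Hypothesis j0 : (0 < j)%N.
Hypothesis D_good : forall d, D d -> forall r s t, (j <= r < j + m)%N ->
  (j <= s < j + m)%N -> (j <= t < j + m)%N -> (r < l)%N -> (s < l)%N -> (t < l)%N ->
  det3 (apex (w d) r) (apex (w d) s) (apex (w d) t) = 0 \/
    eta <= `|det3 (apex (w d) r) (apex (w d) s) (apex (w d) t)|.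

Let Y d := take (j + m) (w d).

Let split_at d d' : D d -> D d' -> Y d != Y d' -> exists t, [/\ (j <= t < j + m)%N, (t < l)%N,
   take t (w d) = take t (w d') & wt (w d) t != wt (w d') t].
Proof.
move=> Dd Dd' ne; have [_ sd] := D_ray Dd; have [_ sd'] := D_ray Dd'.
have [|t [lt et nt]] := @first_difference _ None (Y d) (Y d') _ ne.
  by rewrite /Y !size_take sd sd'.
have [lt1 lt2] : (t < j + m)%N /\ (t < l)%N.
  by move: lt; rewrite /Y size_take sd; case: ifP => h ?; split=> //; lia.
exists t; rewrite /Y !nth_take // in nt; rewrite lt1 lt2 andbT; split=> //.
  rewrite leqNgt; apply/negP => tj; move: nt.
  by rewrite -(nth_take None tj (w d)) -(nth_take None tj (w d')) (D_close Dd Dd').1 eqxx.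
by move: et; rewrite /Y !take_takel //; apply: ltnW.
Qed.

(** If two rays of the same direction parted, [apex_split] would produce a negative square. *)
Let x_neq d d' : D d -> D d' -> Y d != Y d' -> x d != x d'.
Proof.
move=> Dd Dd' ne; have [rd sd] := D_ray Dd; have [rd' sd'] := D_ray Dd'.
have [t [/andP[jt _] tl et nt]] := split_at Dd Dd' ne.
apply/eqP => ex; rewrite -ex in rd'.
have := apex_split rd rd' (leq_trans j0 jt); rewrite sd sd' => /(_ tl tl et nt).
by rewrite -expr2 ltNge sqr_ge0.
Qed.

(** Keep one ray per continuation and sort by direction. The branching times of neighbours have no
    peak by [no_peak], so there are at most 2m gaps between continuations. *)
Lemma window_count : at_most (fun y => exists2 d, D d & Y d = y) (m.*2.+1).
Proof.
move=> s us sY.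
have [ds [Dds eds]] : exists ds : seq T, (forall d, d \in ds -> D d) /\ map Y ds = s.
  elim: s {us} sY => [|y s IH] sY; first by exists [::].
  have [|ds [Dds <-]] := IH; first by move=> z zs; apply: sY; rewrite inE zs orbT.
  have [|d Dd <-] := sY y; first by rewrite inE eqxx.
  by exists (d :: ds); split=> // z; rewrite inE => /predU1P[->|/Dds].
pose le d d' := x d <= x d'.
have le_total : total le by move=> d d'; apply: le_total.
pose es := sort le ds.
have Des d : d \in es -> D d by rewrite mem_sort; apply: Dds.
have ues : uniq (map Y es).
  by rewrite (perm_uniq (perm_map Y (_ : perm_eq es ds))) ?eds // perm_sort.
have -> : size s = size es by rewrite -eds size_map size_sort.
have srt : sorted le es := sort_sorted le_total ds.
case Ees : es => [//|d0 es0]; rewrite -Ees; have Mes : size es = (size es0).+1 by rewrite Ees.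
rewrite Mes ltnS; set M := size es0 in Mes *.
pose d i := nth d0 es i.
have Dd i : (i <= M)%N -> D (d i) by move=> h; apply/Des/mem_nth; rewrite Mes.
have Yne i : (i < M)%N -> Y (d i) != Y (d i.+1).
  move=> h; apply/negP => /eqP e.
  have i1 : (i < size es)%N by rewrite Mes ltnS ltnW.
  have i2 : (i.+1 < size es)%N by rewrite Mes.
  have /eqP : nth (Y d0) (map Y es) i = nth (Y d0) (map Y es) i.+1.
    by rewrite !(nth_map d0).
  by rewrite nth_uniq ?size_map // eqn_leq ltnn andbF.
have xlt i : (i < M)%N -> x (d i) < x (d i.+1).
  move=> h; rewrite lt_neqAle (x_neq (Dd i (ltnW h)) (Dd i.+1 h) (Yne i h)) /=.
  by apply: (sortedP d0 srt); rewrite Mes.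
have exT : forall i, exists t, (i < M)%N -> [/\ (j <= t < j + m)%N, (t < l)%N,
   take t (w (d i)) = take t (w (d i.+1)) & wt (w (d i)) t != wt (w (d i.+1)) t].
  move=> k; case: (ltnP k M) => h; last by exists 0%N.
  by have [t' ht] := split_at (Dd k (ltnW h)) (Dd k.+1 h) (Yne k h); exists t'.
have [t tP] := boolp.choice exT.
apply: (@no_peak_length t j) => [i /tP[] //|i lt].
have lt0 : (i < M)%N by lia. have lt1 : (i.+1 < M)%N by lia.
have [b0 l0 e0 n0] := tP i lt0; have [b1 l1 e1 n1] := tP i.+1 lt1.
have [b2 l2 e2 n2] := tP i.+2 lt.
have [r0 s0] := D_ray (Dd i (ltnW lt0)); have [r1 s1] := D_ray (Dd i.+1 (ltnW lt1)).
have [r2 s2] := D_ray (Dd i.+2 (ltnW lt)); have [r3 s3] := D_ray (Dd i.+3 lt).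
have pos k : (j <= k < j + m)%N -> (0 < k)%N by case/andP => h _; apply: leq_trans h.
apply: (no_peak r0 r1 r2 r3 (xlt _ lt0) (xlt _ lt1) (xlt _ lt)).
- have := (D_close (Dd i.+3 lt) (Dd i (ltnW lt0))).2; exact/le_trans/ler_norm.
- exact/D_tame/Dd/ltnW.
- by rewrite s0 s1; split=> //; apply: pos.
- by rewrite s1 s2; split=> //; apply: pos.
- by rewrite s2 s3; split=> //; apply: pos.
by apply: D_good => //; apply/Dd/ltnW.
Qed.

End Count.

(** The first letter is the starting vertex, and each further block of m letters multiplies the
    count by at most 2m + 1; hence the length 1 + m k. *)
Lemma word_count (T : eqType) (w : T -> seq (option bool)) (x : T -> R)
    (p : T -> nat -> R) (D : T -> Prop) (l m k : nat) :
  (forall d, D d -> ray (w d) (x d) (p d) /\ size (w d) = l) ->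
  (forall d, D d -> tame (w d)) ->
  (forall d d', D d -> D d' -> `|x d - x d'| <= delta) ->
  (forall d, D d -> forall j r s t, (0 < j)%N -> (j <= r < j + m)%N ->
    (j <= s < j + m)%N -> (j <= t < j + m)%N -> (r < l)%N -> (s < l)%N -> (t < l)%N ->
    det3 (apex (w d) r) (apex (w d) s) (apex (w d) t) = 0 \/
      eta <= `|det3 (apex (w d) r) (apex (w d) s) (apex (w d) t)|) ->
  (0 < l)%N -> (l <= 1 + m * k)%N ->
  at_most (fun y => exists2 d, D d & w d = y) (m.*2.+1 ^ k).
Proof.
move=> D_ray D_tame D_close D_good l0 lk.
suff H : at_most (fun y => exists2 d, D d & take (1 + m * k) (w d) = y) (m.*2.+1 ^ k).
  apply: (at_most_sub _ H) => y [d Dd <-]; exists d => //.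
  by rewrite take_oversize // (D_ray d Dd).2.
elim: k {lk} => [|k IH].
  apply: at_most1 => y y' [d Dd <-] [d' Dd' <-]; rewrite muln0 addn0.
  have [[_ h _ _ _] sz] := D_ray d Dd; have [[_ h' _ _ _] sz'] := D_ray d' Dd'.
  move: h h' sz sz'; rewrite /wt; case: (w d) => [|a u]; first by move=> _ _ /=  e; move: l0; rewrite -e.
  case: (w d') => [|a' u'] /=; first by move=> _ _ _ e; move: l0; rewrite -e.
  by rewrite !take0 => -> ->.
have le : (1 + m * k <= 1 + m * k.+1)%N by rewrite leq_add2l leq_mul2l leqnSn orbT.
rewrite expnSr.
apply: (at_most_fibers (g := take (1 + m * k))).
  apply: (at_most_sub _ IH) => y [y' [d Dd <-] <-]; exists d => //.
  by rewrite take_takel.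
move=> z; rewrite mulnS addnCA addnA -addnA (addnC m).
apply: (at_most_sub (Q := fun y => exists2 d, D d /\ take (1 + m * k) (w d) = z
   & take (1 + m * k + m) (w d) = y)).
  move=> y [[d Dd <-]]; rewrite take_takel ?leq_addr // => e.
  by exists d.
apply: (window_count (x := x) (p := p) (l := l)) => //.
- by move=> d [/D_ray].
- by move=> d [/D_tame].
- move=> d d' [Dd e] [Dd' e']; split; first by rewrite e e'.
  exact: D_close.
by move=> d [Dd _] r s t; apply: D_good.
Qed.

End Window.

(** The endpoints of a crossed side lie strictly on opposite sides of the ray, so the ray is not
    parallel to that side. *)
Lemma ray_unique w x p p' t : ray w x p -> ray w x p' -> (t < size w)%N -> p t = p' t.
Proof.
move=> rw rw' lt; have [_ _ _ _ bw] := rw; have [_ _ _ _ bw'] := rw'.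
have [j oi] : exists j, j != wt w t.
  by case: (wt w t) => [[]|]; [exists None|exists None|exists (Some true)].
have [k [k1 k2 _]] := third_vertex oi.
have ok : j != k by rewrite eq_sym.
have b := bw t j k lt ok oi k2; have b' := bw' t j k lt ok oi k2.
have nz := side_neq0 rw lt oi; have op := between_opposite b nz.
move: b b' op => [c [_ _ /= e1 e2]] [c' [_ _ /= e1' e2']].
set I := Vt w t j in e1 e2 e1' e2' *; set J := Vt w t k in e1 e2 e1' e2' * => op.
have f : (1 - c) * offset x I + c * offset x J = 0.
  have -> : (1 - c) * offset x I + c * offset x J = ((1 - c) * I.2 + c * J.2)
     - x * ((1 - c) * I.1 + c * J.1) by rewrite /offset; ring.
  by rewrite -e1 -e2 subrr.
have f' : (1 - c') * offset x I + c' * offset x J = 0.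
  have -> : (1 - c') * offset x I + c' * offset x J = ((1 - c') * I.2 + c' * J.2)
     - x * ((1 - c') * I.1 + c' * J.1) by rewrite /offset; ring.
  by rewrite -e1' -e2' subrr.
have h : (c - c') * (offset x I - offset x J) = 0.
  have -> : (c - c') * (offset x I - offset x J) =
    ((1 - c') * offset x I + c' * offset x J) - ((1 - c) * offset x I + c * offset x J) by ring.
  by rewrite f f' subrr.
move/eqP: h; rewrite mulf_eq0 subr_eq0 => /orP[/eqP e|]; first by rewrite e1 e1' e.
rewrite subr_eq0 => /eqP e; move: op; rewrite e -expr2 ltNge sqr_ge0.
by [].
Qed.

End Strip.

Local Open Scope classical_set_scope.
Local Open Scope ring_scope.
Local Notation Re := complex.Re.
Local Notation Im := complex.Im.

(** * Avoiding small arcs almost surely *)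

Section Phase.
Variable R : realType.
Local Notation C := R[i].
Local Notation mu := (@lebesgue_measure R).

(** Squared modulus, kept real and polynomial in the coordinates so that order and measurability are
    those of [R]. *)
Definition nsq (x : C) : R := Re x ^+ 2 + Im x ^+ 2.

Lemma nsq_ge0 x : 0 <= nsq x. Proof. by rewrite addr_ge0 ?sqr_ge0. Qed.

Lemma nsqM x y : nsq (x * y) = nsq x * nsq y.
Proof. by case: x y => [a b] [c d]; rewrite /nsq /=; ring. Qed.

Lemma nsq1 : nsq 1 = 1. Proof. by rewrite /nsq /=; ring. Qed.

Lemma nsqX x n : nsq (x ^+ n) = nsq x ^+ n.
Proof. by elim: n => [|n IH]; rewrite ?expr0 ?nsq1 // !exprS nsqM IH. Qed.

Lemma nsq_eq0 x : (nsq x == 0) = (x == 0).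
Proof.
case: x => [a b]; rewrite /nsq eq_complex /=.
by rewrite paddr_eq0 ?sqr_ge0 // !sqrf_eq0.
Qed.

Lemma nsq_int (n : int) : n != 0 -> 1 <= nsq n%:~R.
Proof.
move=> n0; rewrite -[n%:~R](rmorph_int (real_complex R)) /nsq /= expr0n addr0.
rewrite -[_ ^+ 2]ger0_norm ?sqr_ge0 // normrX exprn_ege1 //.
by rewrite -intr_norm ler1z; lia.
Qed.

(** The point e^(2ia) of the unit circle. *)
Definition phase (a : R) : C := (cos (a + a) +i* sin (a + a))%C.

Lemma nsq_phase a : nsq (phase a) = 1.
Proof. by rewrite /nsq /= cos2Dsin2. Qed.

Lemma phaseJ a : phase a * (phase a)^*%C = 1.
Proof.
rewrite /phase; apply/eqP; rewrite eq_complex /=; apply/andP; split; apply/eqP.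
  by rewrite -[RHS](cos2Dsin2 (a + a)); ring.
by ring.
Qed.

Lemma nsq_phaseB a b : nsq (phase a - phase b) = 4 * sin (a - b) ^+ 2.
Proof.
rewrite /nsq /=.
have e : cos ((a + a) - (b + b)) = 1 - 2 * sin (a - b) ^+ 2.
  have -> : (a + a) - (b + b) = (a - b) + (a - b) by ring.
  by rewrite cosD -[X in X - _]/(cos (a - b) * cos (a - b)) -!expr2 cos2sin2; ring.
move: e; rewrite cosB => e.
have h1 := cos2Dsin2 (a + a); have h2 := cos2Dsin2 (b + b).
nra.
Qed.

Lemma sin_lower : exists2 r : R, 0 < r & forall t, `|t| <= r -> `|t| <= 2 * `|sin t|.
Proof.
have : \forall t \near (0 : R), 1 / 2 < cos t.
  have c := @continuous_cos R 0; apply: (cvgr_gt _ c); rewrite cos0; lra.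
move=> /nbhs_ballP[r /= r0 hr]; exists (r / 2); first lra.
have pos (t : R) : 0 < t -> t <= r / 2 -> t <= 2 * sin t.
  move=> t0 tr.
  have ds x : x \in `]0, t[ -> is_derive x 1 (sin : R -> R) (cos x) by move=> _; apply: is_derive_sin.
  have cs : {within `[0, t], continuous (sin : R -> R)}.
    by apply: continuous_subspaceT => x; apply: continuous_sin.
  have [c] := MVT t0 ds cs.
  rewrite in_itv /= sin0 !subr0 => /andP[c0 ct] ->.
  have : 1 / 2 < cos c by apply: hr; rewrite /ball /= sub0r normrN gtr0_norm //; lra.
  by nra.
move=> t; have [t0|t0|->] := ltgtP t 0; last by move=> _; rewrite normr0 mulr_ge0.
  rewrite ltr0_norm // => h; have := pos (- t); rewrite sinN oppr_gt0 => /(_ t0 h).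
  by have := ler_norm (- sin t); rewrite normrN; lra.
by rewrite gtr0_norm // => h; have := pos t t0 h; have := ler_norm (sin t); lra.
Qed.

Section Measurability.
Context d (T : measurableType d).
Implicit Types f g : T -> C.

Definition cmeasurable f : Prop :=
  measurable_fun setT (fun t => Re (f t)) /\ measurable_fun setT (fun t => Im (f t)).

Lemma cmeasurable_cst (c : C) : cmeasurable (fun=> c).
Proof. by split; apply: measurable_cst. Qed.

Lemma cmeasurableD f g : cmeasurable f -> cmeasurable g -> cmeasurable (fun t => f t + g t).
Proof.
move=> [f1 f2] [g1 g2]; split.
  apply: (eq_measurable_fun (fun t => Re (f t) + Re (g t))); last exact: measurable_funD.
  by move=> t _; case: (f t) (g t) => [? ?] [? ?].
apply: (eq_measurable_fun (fun t => Im (f t) + Im (g t))); last exact: measurable_funD.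
by move=> t _; case: (f t) (g t) => [? ?] [? ?].
Qed.

Lemma cmeasurableM f g : cmeasurable f -> cmeasurable g -> cmeasurable (fun t => f t * g t).
Proof.
move=> [f1 f2] [g1 g2]; split.
  apply: (eq_measurable_fun (fun t => Re (f t) * Re (g t) - Im (f t) * Im (g t))).
    by move=> t _; case: (f t) (g t) => [? ?] [? ?].
  by apply: measurable_funB; apply: measurable_funM.
apply: (eq_measurable_fun (fun t => Re (f t) * Im (g t) + Im (f t) * Re (g t))).
  by move=> t _; case: (f t) (g t) => [? ?] [? ?].
by apply: measurable_funD; apply: measurable_funM.
Qed.

Lemma cmeasurable_conj f : cmeasurable f -> cmeasurable (fun t => (f t)^*%C).
Proof.
move=> [f1 f2]; split.
  by apply: (eq_measurable_fun (fun t => Re (f t))) => // t _; case: (f t).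
apply: (eq_measurable_fun (fun t => - Im (f t))); last exact: measurableT_comp.
by move=> t _; case: (f t).
Qed.

Lemma cmeasurable_phase (h : T -> R) : measurable_fun setT h ->
  cmeasurable (fun t => phase (h t)).
Proof.
move=> mh; have mh2 : measurable_fun setT (fun t => h t + h t) by apply: measurable_funD.
split; rewrite /phase /=.
  apply: (measurableT_comp (f := cos)) mh2.
  by apply: continuous_measurable_fun; apply: continuous_cos.
apply: (measurableT_comp (f := sin)) mh2.
by apply: continuous_measurable_fun; apply: continuous_sin.
Qed.

Lemma measurable_nsq f : cmeasurable f -> measurable_fun setT (fun t => nsq (f t)).
Proof. by move=> [f1 f2]; apply: measurable_funD; apply: measurable_funX. Qed.

End Measurability.

(** Restricting the parameter to a short window lets [sin_lower] turn small chords into small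
    differences of parameters. *)
Definition arc (L r : R) (z : C) (rho : R) : set R :=
  `[L, L + r] `&` [set a | nsq (phase a - z) < rho ^+ 2].

Lemma nsq_parallelogram (x y u : C) : nsq (x - y) <= 2 * nsq (x - u) + 2 * nsq (y - u).
Proof.
case: x y u => [a b] [c d] [e f]; rewrite /nsq /=.
rewrite -subr_ge0 (_ : _ - _ = (a + c - 2 * e) ^+ 2 + (b + d - 2 * f) ^+ 2); last by ring.
by rewrite addr_ge0 ?sqr_ge0.
Qed.

Lemma measurable_arc L r z rho : measurable (arc L r z rho).
Proof.
apply: measurableI; first exact: measurable_itv.
have m : measurable_fun setT (fun a : R => nsq (phase a - z)).
  apply: measurable_nsq; apply: (cmeasurableD (f := phase)); last exact: cmeasurable_cst.
  exact: cmeasurable_phase.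
rewrite (_ : [set a | _] = setT `&` (fun a : R => nsq (phase a - z)) @^-1` `]-oo, rho ^+ 2[).
  by apply: m => //; apply: measurable_itv.
by rewrite setTI; apply/seteqP; split=> a /=; rewrite in_itv.
Qed.

(** Two phases within rho of z are at distance at most 2 rho, so their parameters differ by at most
    2 rho, and the arc fits in an interval of length 4 rho. *)
Lemma arc_measure (L r : R) z (rho : R) : 0 < r -> 0 < rho ->
  (forall t : R, `|t| <= r -> `|t| <= 2 * `|sin t|) ->
  (mu (arc L r z rho) <= (4 * rho)%:E)%E.
Proof.
move=> r0 rho0 hr.
have [[a0 [/= a0i a0z]]|ne] := pselect (exists a, arc L r z rho a); last first.
  rewrite (_ : arc L r z rho = set0) ?measure0 ?lee_fin ?mulr_ge0 // ?ltW //.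
  by apply/seteqP; split=> a // h; apply: ne; exists a.
pose J : set R := `[a0 - 2 * rho, a0 + 2 * rho]%classic.
have le : (mu (arc L r z rho) <= mu J)%E.
  apply: le_measure; rewrite ?inE; [exact: measurable_arc|exact: measurable_itv|].
  move=> a [/= ai az]; move: ai a0i; rewrite !in_itv /= => /andP[i1 i2] /andP[j1 j2].
  have h1 := nsq_parallelogram (phase a) (phase a0) z.
  rewrite nsq_phaseB in h1.
  have h2 : `|sin (a - a0)| <= rho.
    rewrite -(@ler_pXn2r _ 2) ?nnegrE ?normr_ge0 ?(ltW rho0) // real_normK ?num_real //; lra.
  have h3 : `|a - a0| <= r by rewrite ler_norml; apply/andP; split; lra.
  have : `|a - a0| <= 2 * rho by apply: le_trans (hr _ h3) _; lra.
  by rewrite ler_norml => /andP[? ?]; rewrite /J /= in_itv /=; apply/andP; split; lra.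
apply: le_trans le _; rewrite /J lebesgue_measure_itv /= lte_fin.
case: ifP => _; last by rewrite lee_fin mulr_ge0 // ltW.
by rewrite -EFinB lee_fin; lra.
Qed.

(** Borel-Cantelli in each window of length r: the arcs of stage m have total measure at most 4 c /
    2^m, which is summable. Countably many windows cover the line. *)
Lemma ae_avoid (Z : nat -> seq C) (rho : nat -> R) (c : R) :
  (forall m, 0 < rho m) -> (forall m, (size (Z m))%:R * rho m <= c / 2 ^+ m) ->
  {ae mu, forall a : R, exists m0, forall m, (m0 <= m)%N ->
     forall z, z \in Z m -> rho m ^+ 2 <= nsq (phase a - z)}.
Proof.
move=> rho0 sm; have [r r0 hr] := sin_lower.
pose F L m : set R := \big[setU/set0]_(z <- Z m) arc L r z (rho m).
have mF L m : measurable (F L m) by apply: bigsetU_measurable => z _; apply: measurable_arc.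
have c0 : 0 <= c.
  have := sm 0%N; rewrite expr0 divr1; apply: le_trans.
  by rewrite mulr_ge0 // ltW.
(* This is 4 c / 2^m in the shape summed by [epsilon_trick0]. *)
have muF L m : (mu (F L m) <= (8 * c / (2 ^ m.+1)%:R)%:E)%E.
  have : (mu (F L m) <= ((size (Z m))%:R * (4 * rho m))%:E)%E.
    rewrite /F; elim: (Z m) => [|z s IH]; first by rewrite big_nil measure0 /= mul0r.
    rewrite big_cons; apply: le_trans (measureU2 _ _ _) _.
    - exact: measurable_arc.
    - by apply: bigsetU_measurable => z' _; apply: measurable_arc.
    by rewrite /= -addn1 natrD mulrDl mul1r addrC EFinD leeD // arc_measure.
  move/le_trans; apply; rewrite lee_fin natrX exprS.
  have -> : 8 * c / (2 * 2 ^+ m) = 4 * (c / 2 ^+ m) :> R.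
    by field; rewrite expf_neq0.
  have := sm m; lra.
have negl L : mu.-negligible (lim_sup_set (F L)).
  have h : mu (lim_sup_set (F L)) = 0%E.
    apply: lim_sup_set_cvg0; first exact: mF.
    have h0 : (\sum_(0 <= n <oo) mu (F L n) <= (8 * c)%:E)%E.
      apply: le_trans (epsilon_trick0 xpredT _); last by rewrite mulr_ge0.
      by apply: lee_nneseries => // n _; apply: muF.
    exact: (le_lt_trans h0 (ltry _)).
  exists (lim_sup_set (F L)); split=> //.
  by apply: bigcapT_measurable => n; apply: bigcup_measurable => k _; exact: mF.
(* The windows [n r, (n+1) r] cover the nonnegative parameters and the windows [-(n+1) r, -n r] the
   negative ones. *)
have negN : mu.-negligible (\bigcup_n (lim_sup_set (F (n%:R * r)) `|` lim_sup_set (F (- (n.+1%:R * r))))).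
  by apply: negligible_bigcup => n; apply: negligibleU.
apply: negligibleS negN => a /= Na.
have inF L : a \in `[L, L + r] -> lim_sup_set (F L) a.
  move=> aL m0 _ /=; apply: contrapT => h; apply: Na; exists m0 => m lm z zZ.
  rewrite leNgt; apply/negP => lt; apply: h; exists m => //.
  rewrite /F; elim: (Z m) zZ => [//|z' s IH]; rewrite inE big_cons => /predU1P[<-|/IH h]; first by left.
  by right.
have [a0|a0] := leP 0 a.
  have /truncn_itv/andP[h1 h2] : 0 <= a / r by rewrite divr_ge0 // ltW.
  exists (Num.trunc (a / r)) => //; left; apply: inF.
  rewrite in_itv /=; rewrite ler_pdivlMr // in h1; rewrite ltr_pdivrMr // in h2.
  by rewrite h1 -natr1 mulrDl mul1r in h2 *; rewrite ltW.
have /truncn_itv/andP[h1 h2] : 0 <= - a / r by rewrite divr_ge0 ?oppr_ge0 // ltW.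
exists (Num.trunc (- a / r)) => //; right; apply: inF.
rewrite in_itv /=; rewrite ler_pdivlMr // in h1; rewrite ltr_pdivrMr // in h2.
move: h1 h2; rewrite -natr1 mulrDl mul1r => h1 h2; apply/andP; split; lra.
Qed.

End Phase.

(** * Integer Laurent polynomials in two phases *)

Lemma ae_impl d (T : measurableType d) (R : realType) (m : {measure set T -> \bar R})
    (P Q : T -> Prop) :
  (forall x, P x -> Q x) -> {ae m, forall x, P x} -> {ae m, forall x, Q x}.
Proof. by move=> PQ; apply: negligibleS => x /= nQ /PQ. Qed.

Section Laurent.
Variable R : realType.
Local Notation C := R[i].
Local Notation mu := (@lebesgue_measure R).

Definition roots_of (p : {poly C}) : seq C := sval (closed_field_poly_normal p).

Lemma roots_ofP (p : {poly C}) : p = lead_coef p *: \prod_(z <- roots_of p) ('X - z%:P).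
Proof. exact: svalP (closed_field_poly_normal p). Qed.

Lemma size_roots_of (p : {poly C}) : p != 0 -> (size (roots_of p)).+1 = size p.
Proof.
move=> p0; rewrite [in RHS](roots_ofP p) size_scale ?lead_coef_eq0 //.
by rewrite size_prod_XsubC.
Qed.

(** In the factorization over the roots each factor is at least e; since e is at most 1, the degree
    bound D may replace the number of roots. *)
Lemma nsq_horner_lower (p : {poly C}) (x : C) (e : R) (D : nat) :
  0 <= e -> e <= 1 -> (size p <= D.+1)%N ->
  (forall z, z \in roots_of p -> e <= nsq (x - z)) ->
  nsq (lead_coef p) * e ^+ D <= nsq p.[x].
Proof.
move=> e0 e1 sp far; have [->|p0] := eqVneq p 0.
  by rewrite lead_coef0 horner0 /nsq /= expr0n addr0 mul0r.
have sD : (size (roots_of p) <= D)%N by rewrite -ltnS size_roots_of.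
rewrite [in leRHS](roots_ofP p) hornerZ nsqM ler_wpM2l ?nsq_ge0 //.
apply: (@le_trans _ _ (e ^+ size (roots_of p))); first exact: ler_wiXn2l.
elim: (roots_of p) far {sD} => [|z s IH] far; first by rewrite big_nil hornerC nsq1.
rewrite big_cons hornerM nsqM /= exprS hornerXsubC ler_pM ?exprn_ge0 //.
  by apply: far; rewrite inE eqxx.
by apply: IH => z' zs; apply: far; rewrite inE zs orbT.
Qed.

(** Stage m has at most c k^m c (m+1) roots in all. With radius (4k)^-m around each, [ae_avoid]
    applies: one factor 2^-m absorbs m + 1 and the other gives summability. *)
Lemma ae_poly_lower (I : nat -> finType) (p : forall m, I m -> {poly C}) (D : nat -> nat)
    (c k : nat) : (0 < k)%N ->
  (forall m, (#|I m| <= c * k ^ m)%N) -> (forall m, (D m <= c * m.+1)%N) ->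
  (forall m i, (size (p m i) <= (D m).+1)%N) ->
  {ae mu, forall a : R, exists m0, forall m, (m0 <= m)%N -> forall i : I m,
    nsq (lead_coef (p m i)) * ((4 * k)%:R ^- m) ^+ (2 * D m) <= nsq (p m i).[phase a]}.
Proof.
move=> k0 cI cD sp; pose rho m : R := (4 * k)%:R ^- m.
pose Z m := flatten [seq roots_of (p m i) | i <- enum (I m) & p m i != 0].
have q0 : 0 < (4 * k)%:R :> R by rewrite ltr0n muln_gt0.
have rho0 m : 0 < rho m by rewrite invr_gt0 exprn_gt0.
have sZ m : (size (Z m) <= #|I m| * D m)%N.
  rewrite /Z cardE; elim: (enum (I m)) => [//|i s IH] /=.
  case: ifP => pi /=; last by apply: leq_trans IH _; rewrite mulSn leq_addl.
  by rewrite size_cat mulSn leq_add // -ltnS size_roots_of.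
have := @ae_avoid R Z rho (c * c)%:R rho0.
have h m : (size (Z m))%:R * rho m <= (c * c)%:R / 2 ^+ m.
  rewrite /rho ler_pdivrMr ?exprn_gt0 // mulrAC ler_pdivlMr ?exprn_gt0 //.
  rewrite -!natrX -!natrM ler_nat.
  apply: leq_trans (leq_mul (leq_trans (sZ m) (leq_mul (cI m) (cD m))) (leqnn _)) _.
  have e : (m.+1 <= 2 ^ m)%N by apply: ltn_expl.
  apply: (@leq_trans (c * k ^ m * (c * 2 ^ m) * 2 ^ m)).
    by rewrite leq_mul2r leq_mul2l leq_mul2l e !orbT.
  rewrite expnMn (_ : 4 = 2 * 2)%N // expnMn; apply/eq_leq; ring.
move=> /(_ h); apply: ae_impl => a [m0 hm]; exists m0 => m /hm {}hm i.
have [->|p0] := eqVneq (p m i) 0.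
  by rewrite lead_coef0 horner0 /nsq /= expr0n addr0 mul0r.
rewrite exprM -/(rho m); apply: nsq_horner_lower => //.
- by rewrite exprn_ge0 // ltW.
- apply: exprn_ile1; first exact: ltW.
  by rewrite /rho invf_le1 ?exprn_gt0 // exprn_ege1 // ler1n muln_gt0.
move=> z zp; apply: hm; apply/flattenP; exists (roots_of (p m i)) => //.
by apply/mapP; exists i; rewrite // mem_filter p0 mem_enum.
Qed.

Definition eval1 (z : C) : {poly int} -> C := horner_eval z \o map_poly (intr : int -> C).
HB.instance Definition _ z := GRing.RMorphism.copy (eval1 z)
  (horner_eval z \o map_poly (intr : int -> C)).
(** The inner variable stands for the first phase and the outer one for the second, so fixing the
    first angle leaves a polynomial in the second phase. *)
Definition eval2 (P : {poly {poly int}}) (z w : C) : C := (map_poly (eval1 z) P).[w].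

Definition bidegree (d : nat) (P : {poly {poly int}}) : Prop :=
  (size P <= d.+1)%N /\ forall i, (size (P`_i)%R <= d.+1)%N.

(* Laurent polynomials in the two phases, exponents in [-d, d], with denominators cleared. *)
Definition half_laurent (d : nat) (f : R * R -> C) : Prop :=
  exists2 P, bidegree d.*2 P & forall ab,
    eval2 P (phase ab.1) (phase ab.2) = f ab * (phase ab.1 * phase ab.2) ^+ d.

(** The conjugate is carried along because reflections conjugate; on the unit circle conjugation
    inverts the phases and keeps integer coefficients. *)
Definition laurent (d : nat) (f : R * R -> C) : Prop :=
  [/\ cmeasurable f, half_laurent d f & half_laurent d (fun ab => (f ab)^*%C)].

Lemma eval2D P Q z w : eval2 (P + Q) z w = eval2 P z w + eval2 Q z w.
Proof. by rewrite /eval2 rmorphD hornerD. Qed.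
Lemma eval2N P z w : eval2 (- P) z w = - eval2 P z w.
Proof. by rewrite /eval2 rmorphN hornerN. Qed.
Lemma eval2M P Q z w : eval2 (P * Q) z w = eval2 P z w * eval2 Q z w.
Proof. by rewrite /eval2 rmorphM hornerM. Qed.
Lemma eval2C p z w : eval2 p%:P z w = eval1 z p.
Proof. by rewrite /eval2 map_polyC hornerC. Qed.
Lemma eval2X z w : eval2 'X z w = w.
Proof. by rewrite /eval2 map_polyX hornerX. Qed.
Lemma eval1X z : eval1 z 'X = z.
Proof. by rewrite /eval1 /= map_polyX /horner_eval hornerX. Qed.

Lemma bidegreeD d P Q : bidegree d P -> bidegree d Q -> bidegree d (P + Q).
Proof.
move=> [p1 p2] [q1 q2]; split=> [|i]; rewrite ?coefD.
  by apply: leq_trans (size_polyD _ _) _; rewrite geq_max p1 q1.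
by apply: leq_trans (size_polyD _ _) _; rewrite geq_max p2 q2.
Qed.

Lemma bidegreeM d e P Q : bidegree d P -> bidegree e Q -> bidegree (d + e) (P * Q).
Proof.
move=> [p1 p2] [q1 q2]; split=> [|i].
  by apply: leq_trans (size_polyMleq _ _) _; lia.
rewrite coefM; apply: leq_trans (size_sum _ _ _) _.
apply/bigmax_leqP => j _; apply: leq_trans (size_polyMleq _ _) _.
have := p2 j; have := q2 (i - j)%N; lia.
Qed.

Lemma bidegreeN d P : bidegree d P -> bidegree d (- P).
Proof. by move=> [p1 p2]; split=> [|i]; rewrite ?coefN size_polyN. Qed.

Lemma bidegree_mono d P : bidegree d P -> bidegree d.+1 P.
Proof. by move=> [p1 p2]; split=> [|i]; apply: leqW. Qed.

Lemma bidegreeC d (p : {poly int}) : (size p <= d.+1)%N -> bidegree d p%:P.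
Proof.
move=> sp; split=> [|i]; first by apply: leq_trans (size_polyC_leq1 _) _.
by rewrite coefC; case: ifP => // _; rewrite size_poly0.
Qed.

Lemma bidegreeX : bidegree 1 'X.
Proof. by split=> [|i]; rewrite ?size_polyX // coefX; case: eqP; rewrite ?size_poly0 ?size_poly1. Qed.

Lemma bidegree_monomial d n (p : {poly int}) : (n <= d)%N -> (size p <= d.+1)%N ->
  bidegree d ('X^n * p%:P).
Proof.
move=> nd sp; split=> [|i].
  apply: leq_trans (size_polyMleq _ _) _; rewrite size_polyXn.
  by rewrite addSn /=; apply: leq_trans (leq_add nd (size_polyC_leq1 p)) _; rewrite addn1.
rewrite coefXnM coefC; case: ifP => _; first by rewrite size_poly0.
by case: ifP => // _; rewrite size_poly0.
Qed.

Lemma half_laurentD d f g : half_laurent d f -> half_laurent d g ->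
  half_laurent d (fun ab => f ab + g ab).
Proof.
move=> [P dP eP] [Q dQ eQ]; exists (P + Q); first exact: bidegreeD.
by move=> ab; rewrite eval2D eP eQ mulrDl.
Qed.

Lemma half_laurentM d e f g : half_laurent d f -> half_laurent e g ->
  half_laurent (d + e) (fun ab => f ab * g ab).
Proof.
move=> [P dP eP] [Q dQ eQ]; exists (P * Q); first by rewrite doubleD; apply: bidegreeM.
by move=> ab; rewrite eval2M eP eQ exprD mulrACA.
Qed.

Lemma half_laurentN d f : half_laurent d f -> half_laurent d (fun ab => - f ab).
Proof.
move=> [P dP eP]; exists (- P); first exact: bidegreeN.
by move=> ab; rewrite eval2N eP mulNr.
Qed.

Lemma half_laurent1 d : half_laurent d (fun=> 1).
Proof.
elim: d => [|d [P dP eP]].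
  exists 1; first by split=> [|i]; rewrite ?size_poly1 // coef1; case: eqP; rewrite ?size_poly0 ?size_poly1.
  by move=> ab; rewrite expr0 mulr1 /eval2 rmorph1 hornerC.
(* Raising d by one multiplies the cleared numerator by both phases. *)
exists ('X * 'X%:P * P).
  rewrite doubleS -[_.*2.+2]/(1 + 1 + d.*2)%N; apply: bidegreeM => //.
  by apply: bidegreeM; [exact: bidegreeX | apply: bidegreeC; rewrite size_polyX].
move=> ab; rewrite !eval2M eval2C eval2X eval1X eP !mul1r exprS; ring.
Qed.

Lemma laurent1 d : laurent d (fun=> 1).
Proof.
split; [exact: cmeasurable_cst | exact: half_laurent1 |].
by rewrite (_ : (fun=> _) = fun=> 1); [exact: half_laurent1 | apply/funext => ab; rewrite conjc1].
Qed.

Lemma laurentD d f g : laurent d f -> laurent d g -> laurent d (fun ab => f ab + g ab).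
Proof.
move=> [m1 f1 f2] [m2 g1 g2]; split; [exact: cmeasurableD | exact: half_laurentD |].
rewrite (_ : (fun=> _) = fun ab => (f ab)^*%C + (g ab)^*%C); first exact: half_laurentD.
by apply/funext => ab; rewrite rmorphD.
Qed.

Lemma laurentM d e f g : laurent d f -> laurent e g -> laurent (d + e) (fun ab => f ab * g ab).
Proof.
move=> [m1 f1 f2] [m2 g1 g2]; split; [exact: cmeasurableM | exact: half_laurentM |].
rewrite (_ : (fun=> _) = fun ab => (f ab)^*%C * (g ab)^*%C); first exact: half_laurentM.
by apply/funext => ab; rewrite rmorphM.
Qed.

Lemma laurentN d f : laurent d f -> laurent d (fun ab => - f ab).
Proof.
move=> [m1 f1 f2]; split; [|exact: half_laurentN|].
  rewrite (_ : (fun=> _) = fun ab => -1 * f ab); last by apply/funext => ab; rewrite mulN1r.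
  by apply: cmeasurableM => //; apply: cmeasurable_cst.
rewrite (_ : (fun=> _) = fun ab => - (f ab)^*%C); first exact: half_laurentN.
by apply/funext => ab; rewrite rmorphN.
Qed.

Lemma laurentB d f g : laurent d f -> laurent d g -> laurent d (fun ab => f ab - g ab).
Proof. by move=> lf lg; apply: laurentD => //; apply: laurentN. Qed.

Lemma laurent_conj d f : laurent d f -> laurent d (fun ab => (f ab)^*%C).
Proof.
move=> [m1 f1 f2]; split=> //; first exact: cmeasurable_conj.
by rewrite (_ : (fun=> _) = f) //; apply/funext => ab; rewrite conjcK.
Qed.

Lemma laurent_leq d e f : (d <= e)%N -> laurent d f -> laurent e f.
Proof.
move=> le lf; rewrite -(subnKC le) (_ : f = fun ab => f ab * 1).
  by apply: laurentM => //; apply: laurent1.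
by apply/funext => ab; rewrite mulr1.
Qed.

Lemma laurent0 d : laurent d (fun=> 0).
Proof.
rewrite (_ : (fun=> 0) = fun=> 1 - 1); last by apply/funext => ab; rewrite subrr.
by apply: laurentB; apply: laurent1.
Qed.

Lemma laurent_phase1 : laurent 1 (fun ab => phase ab.1).
Proof.
split; first by apply: cmeasurable_phase; exact: measurable_fst.
  (* With d = 1 the numerator of z is z (z w) = z^2 w, and that of its conjugate is z^-1 (z w) =
     w. *)
  exists ('X^1 * ('X^2)%:P); first by apply: bidegree_monomial; rewrite ?size_polyXn.
  by move=> ab; rewrite eval2M eval2C expr1 eval2X rmorphXn /= eval1X; ring.
exists 'X; first exact/bidegree_mono/bidegreeX.
by move=> ab; rewrite eval2X expr1 mulrA (mulrC _^*%C) phaseJ mul1r.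
Qed.

Lemma laurent_phase2 : laurent 1 (fun ab => phase ab.2).
Proof.
split; first by apply: cmeasurable_phase; exact: measurable_snd.
  exists ('X^2 * 'X%:P); first by apply: bidegree_monomial; rewrite ?size_polyX.
  by move=> ab; rewrite eval2M eval2C expr2 eval2M eval2X eval1X; ring.
exists 'X%:P; first by apply: bidegreeC; rewrite size_polyX.
by move=> ab; rewrite eval2C eval1X expr1 mulrCA (mulrC _^*%C) phaseJ mulr1.
Qed.

End Laurent.

(** * From one angle to two: Fubini and lower bounds for Laurent polynomials *)

Section Plane.
Variable R : realType.
Local Notation C := R[i].
Local Notation mu := (@lebesgue_measure R).

(** The product measure of the complement is the integral of the measures of its sections, almost
    all of which are 0. *)
Lemma ae_product (G : set (R * R)) : measurable G ->
  {ae mu, forall a : R, {ae mu, forall b : R, G (a, b)}} ->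
  {ae (mu \x mu)%E, forall ab : R * R, G ab}.
Proof.
move=> mG aeG; exists (~` G); split=> //; first exact: measurableC.
have mB : measurable (~` G) by apply: measurableC.
rewrite /product_measure1.
rewrite (ge0_ae_eq_integral (g := cst 0%E)) ?integral0 //.
- exact: measurable_fun_xsection.
- apply: ae_impl aeG => a h _ /=.
  apply: measure_negligible; first exact: measurable_xsection.
  by apply: negligibleS h => b; rewrite /xsection /= inE.
Qed.

(** [ae_poly_lower] is used twice. For almost every a it bounds from below the leading coefficient
    in the second variable, whose own leading coefficient is a nonzero integer; for almost every b
    it then bounds the whole polynomial. Each use contributes 4 d to the exponent. *)
Lemma ae_laurent (I : nat -> finType) (f : forall m, I m -> R * R -> C) (d : nat -> nat)
    (c k : nat) : (0 < k)%N ->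
  (forall m, (#|I m| <= c * k ^ m)%N) -> (forall m, ((d m).*2 <= c * m.+1)%N) ->
  (forall m i, laurent (d m) (f m i)) ->
  {ae (mu \x mu)%E, forall ab : R * R, exists m0, forall m, (m0 <= m)%N -> forall i : I m,
    f m i ab = 0 \/ ((4 * k)%:R ^- m) ^+ (8 * d m) <= nsq (f m i ab)}.
Proof.
move=> k0 cI cd lf; pose e m : R := ((4 * k)%:R ^- m) ^+ (8 * d m).
have [P PP] : {P : forall m, I m -> {poly {poly int}} & forall m i, bidegree (d m).*2 (P m i) /\
    forall ab, eval2 (P m i) (phase ab.1) (phase ab.2) =
      f m i ab * (phase ab.1 * phase ab.2) ^+ d m}.
  have ex m i : exists P, bidegree (d m).*2 P /\
    forall ab, eval2 P (phase ab.1) (phase ab.2) = f m i ab * (phase ab.1 * phase ab.2) ^+ d m.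
    by have [_ [Q dQ eQ] _] := lf m i; exists Q.
  exists (fun m i => projT1 (cid (ex m i))) => m i; exact: projT2 (cid (ex m i)).
(* The alternative [P m i = 0] does not depend on the angles, so only the inequality has to be shown
   measurable. *)
pose G : set (R * R) := [set ab | exists m0, forall m, (m0 <= m)%N -> forall i : I m,
  P m i = 0 \/ e m <= nsq (f m i ab)].
have mG : measurable G.
  rewrite (_ : G = \bigcup_m0 \bigcap_(m in [set m | (m0 <= m)%N]) \bigcap_(i in [set: I m])
      [set ab | P m i = 0 \/ e m <= nsq (f m i ab)]); last first.
    apply/seteqP; split=> [ab [m0 h]|ab [m0 _ h]]; first by exists m0 => // m /= lm i _; apply: h.
    by exists m0 => m lm i; apply: (h m lm i).
  apply: bigcup_measurable => m0 _; apply: bigcap_measurable => [|m lm]; first by exists m0 => /=.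
  apply: fin_bigcap_measurable => // i _.
  have [p0|p0] := eqVneq (P m i) 0.
    by rewrite (_ : [set _ | _] = setT) //; apply/seteqP; split=> // ab _; left.
  have [mf _ _] := lf m i; have mn := measurable_nsq mf.
  rewrite (_ : [set _ | _] = setT `&` (fun ab => nsq (f m i ab)) @^-1` `[e m, +oo[).
    by apply: mn => //; apply: measurable_itv.
  rewrite setTI; apply/seteqP; split=> ab /=; rewrite in_itv /= andbT; last by right.
  by case=> // h; rewrite h eqxx in p0.
suff : {ae (mu \x mu)%E, forall ab, G ab}.
  apply: ae_impl => ab [m0 h]; exists m0 => m lm i; have [p0|] := h m lm i; last by right.
  left; have [_ /(_ ab)] := PP m i; rewrite p0 /eval2 rmorph0 horner0 => /esym/eqP.
  rewrite mulf_eq0 expf_eq0 => /orP[/eqP //|/andP[_]].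
  by rewrite -nsq_eq0 nsqM !nsq_phase mulr1 oner_eq0.
apply: ae_product => //.
pose r m : R := (4 * k)%:R ^- m.
have r0 m : 0 < r m by rewrite invr_gt0 exprn_gt0 // ltr0n muln_gt0.
pose Q m i : {poly C} := map_poly intr (lead_coef (P m i)).
have cd' m : ((d m).*2 <= c * m.+1)%N := cd m.
have := @ae_poly_lower R I Q (fun m => (d m).*2) c k k0 cI cd'.
have sQ m i : (size (Q m i) <= (d m).*2.+1)%N.
  by apply: leq_trans (size_poly _ _) _; case: (PP m i) => [[_ h] _]; apply: h.
move=> /(_ sQ); apply: ae_impl => a [m1 h1].
pose S m i : {poly C} := map_poly (eval1 (phase a)) (P m i).
have sS m i : (size (S m i) <= (d m).*2.+1)%N.
  by apply: leq_trans (size_poly _ _) _; case: (PP m i) => [[h _] _].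
have := @ae_poly_lower R I S (fun m => (d m).*2) c k k0 cI cd' sS.
apply: ae_impl => b [m2 h2]; exists (maxn m1 m2) => m; rewrite geq_max => /andP[l1 l2] i.
have [p0|p0] := eqVneq (P m i) 0; [by left | right].
have /= hQ := h1 m l1 i; have /= hS := h2 m l2 i.
have lQ : lead_coef (Q m i) = (lead_coef (lead_coef (P m i)))%:~R.
  apply: lead_coef_map_eq; rewrite intr_eq0 lead_coef_eq0 lead_coef_eq0 //.
have n1 : 1 <= nsq (lead_coef (Q m i)).
  by rewrite lQ nsq_int // !lead_coef_eq0.
have lS : r m ^+ (2 * (d m).*2) <= nsq (lead_coef (S m i)).
  have hl : (Q m i).[phase a] = eval1 (phase a) (lead_coef (P m i)) by [].
  have pos : 0 < r m ^+ (2 * (d m).*2) by rewrite exprn_gt0.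
  have le : r m ^+ (2 * (d m).*2) <= nsq (Q m i).[phase a].
    by apply: le_trans hQ; rewrite ler_peMl // ltW.
  rewrite /S lead_coef_map_eq -?hl // -nsq_eq0 gt_eqF //.
  exact: lt_le_trans le.
have -> : nsq (f m i (a, b)) = nsq (S m i).[phase b].
  have [_ /(_ (a, b)) /= h] := PP m i; rewrite -/(eval2 _ _ _) h nsqM nsqX nsqM !nsq_phase.
  by rewrite mulr1 expr1n mulr1.
apply: le_trans hS; rewrite /e -/(r m).
have -> : (8 * d m = 2 * (d m).*2 + 2 * (d m).*2)%N by lia.
by rewrite exprD ler_wpM2r // exprn_ge0 // ltW.
Qed.

End Plane.

(** * Unfolding by reflections *)

Section Unfold.
Variable R : realType.
Local Notation C := R[i].
Local Notation mu := (@lebesgue_measure R).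
Local Notation normc := (@complex.ComplexField.Normc.normc R).

(** The cyclic order A, B, C: the side opposite to [o] runs from [next o] to [next (next o)]. *)
Definition next (o : option bool) : option bool :=
  match o with None => Some false | Some false => Some true | Some true => None end.

Lemma next_other o i : i != o -> i = next o \/ i = next (next o).
Proof. by case: o i => [[]|] [[]|] //; [right|left|left|right|right|left]. Qed.

Section Fixed.
Variables z w : C.

(* None, Some false, Some true stand for A, B, C.  The triangle of Defs is scaled by
   z w - 1, where z = e^(2ia) and w = e^(2ib), so that its vertices are polynomials. *)
Definition vtx (o : option bool) : C :=
  match o with None => 0 | Some false => z * w - 1 | Some true => z * w - z end.

(** Reflection in a line of direction d has linear part x -> (d / conj d) conj x; this is the factor
    d / conj d for the side opposite to [o]. *)
Definition rot (o : option bool) : C :=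
  match o with None => - z | Some false => - (z * z * w) | Some true => - (z * w) end.

(** Only the line of the side opposite to A misses the origin, so only its reflection has a
    translation part. *)
Definition shift (o : option bool) : C :=
  match o with None => z * w - 1 + w^*%C - z | _ => 0 end.

(* the reflection in the side opposite to o *)
Definition sigma o (x : C) : C := shift o + rot o * x^*%C.

(** This carries the base triangle to the one reached after crossing u. Reflecting in an unfolded
    side amounts to reflecting in the base side first, so the last letter acts first. *)
Definition Phi (u : seq (option bool)) (x : C) : C := foldr sigma x u.

Hypothesis z1 : z * z^*%C = 1.
Hypothesis w1 : w * w^*%C = 1.

Lemma sigma_vtx o i : i != o -> sigma o (vtx i) = vtx i.
Proof.
have z0 : z != 0 by apply/eqP => e; move/eqP: z1; rewrite e mul0r eq_sym oner_eq0.
have w0 : w != 0 by apply/eqP => e; move/eqP: w1; rewrite e mul0r eq_sym oner_eq0.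
have ez : z^*%C = z^-1 by apply: (mulfI z0); rewrite z1 divff.
have ew : w^*%C = w^-1 by apply: (mulfI w0); rewrite w1 divff.
by case: o i => [[]|] [[]|] // _; rewrite /sigma /vtx /rot /shift ?conjc0 ?mulr0 ?addr0 //
  rmorphB rmorphM ?rmorph1 /= ez ew; field; rewrite ?z0 ?w0.
Qed.

Lemma rot_unit o : rot o * (rot o)^*%C = 1.
Proof.
case: o => [[]|] /=; rewrite rmorphN mulrNN ?rmorphM //=.
  have -> : z * w * (z^*%C * w^*%C) = (z * z^*%C) * (w * w^*%C) by ring.
  by rewrite z1 w1 mulr1.
have -> : z * z * w * (z^*%C * z^*%C * w^*%C) = (z * z^*%C) ^+ 2 * (w * w^*%C) by ring.
by rewrite z1 w1 mulr1 expr1n.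
Qed.

Lemma sigmaB o x y : sigma o x - sigma o y = rot o * (x - y)^*%C.
Proof. by rewrite /sigma rmorphB; ring. Qed.

Lemma sigma_inj o : injective (sigma o).
Proof.
move=> x y /eqP; rewrite -subr_eq0 sigmaB mulf_eq0 conjc_eq0 subr_eq0 => /orP[/eqP e|/eqP //].
by have /eqP := rot_unit o; rewrite e mul0r eq_sym oner_eq0.
Qed.

Lemma Phi_inj u : injective (Phi u).
Proof. by elim: u => [//|o u IH] x y /sigma_inj /IH. Qed.

Lemma Phi_rcons u o x : Phi (rcons u o) x = Phi u (sigma o x).
Proof. by rewrite /Phi foldr_rcons. Qed.

Lemma Phi_cat u v x : Phi (u ++ v) x = Phi u (Phi v x).
Proof. by rewrite /Phi foldr_cat. Qed.

Lemma conj_scale (l : R) (x : C) : (l%:C%C * x)^*%C = l%:C%C * x^*%C.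
Proof. by case: x => [a b]; apply/eqP; rewrite eq_complex /=; apply/andP; split; apply/eqP; ring. Qed.

Lemma Phi_scale u (x y x' y' : C) (l : R) : x - y = l%:C%C * (x' - y') ->
  Phi u x - Phi u y = l%:C%C * (Phi u x' - Phi u y').
Proof.
move=> e; elim: u => [//|o u IH] /=.
by rewrite !sigmaB IH conj_scale; ring.
Qed.

Definition cross (x y : C) : R := Re x * Im y - Im x * Re y.

Lemma cross_rot o x y : cross (rot o * x^*%C) (rot o * y^*%C) = - cross x y.
Proof.
have h : nsq (rot o) = 1.
  have := congr1 (@complex.Re R) (rot_unit o); case: (rot o) => [a b]; rewrite /nsq /= => <-; ring.
rewrite -[RHS]mulr1 -h /cross /nsq; case: (rot o) x y => [a b] [c d] [e f] /=; ring.
Qed.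

Lemma cross_Phi u x y s : cross (Phi u y - Phi u x) (Phi u s - Phi u x) =
  (-1) ^+ size u * cross (y - x) (s - x).
Proof.
elim: u => [|o u IH] /=; first by rewrite mul1r.
by rewrite !sigmaB cross_rot IH exprS mulN1r mulNr.
Qed.

Lemma normc_unit (x : C) : x * x^*%C = 1 -> normc x = 1.
Proof.
case: x => [a b] /(congr1 (@complex.Re R)) /= h; rewrite -sqrtr1; congr (Num.sqrt _); rewrite -h; ring.
Qed.

Lemma normc_conj (x : C) : normc x^*%C = normc x.
Proof. by case: x => [a b] /=; rewrite sqrrN. Qed.

Lemma normc_leD (x y : C) : normc (x + y) <= normc x + normc y.
Proof. exact: complex.le_normcD. Qed.

Lemma normc_opp (x : C) : normc (- x) = normc x.
Proof. exact: complex.normcN. Qed.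

Lemma normc_Phi u x : normc (Phi u x) <= 4 * (size u)%:R + normc x.
Proof.
have nz := normc_unit z1; have nw := normc_unit w1.
elim: u => [|o u IH] /=; first by rewrite mulr0 add0r.
apply: le_trans (normc_leD _ _) _; rewrite complex.ComplexField.Normc.normcM (normc_unit (rot_unit o)) mul1r normc_conj.
have h : normc (shift o) <= 4.
  case: o => [[]|]; rewrite /shift ?complex.ComplexField.Normc.normc0 //.
  apply: le_trans (normc_leD _ _) _; rewrite normc_opp nz.
  have := normc_leD (z * w - 1) w^*%C; rewrite normc_conj nw.
  have := normc_leD (z * w) (- 1); rewrite normc_opp complex.ComplexField.Normc.normcM nz nw.
  by rewrite complex.ComplexField.Normc.normc1; lra.
rewrite -[(size u).+1]addn1 natrD mulrDr mulr1; lra.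
Qed.

Lemma normc_vtx i : normc (vtx i) <= 2.
Proof.
have nz := normc_unit z1; have nw := normc_unit w1.
case: i => [[]|]; rewrite /vtx; last by rewrite complex.ComplexField.Normc.normc0.
  by apply: le_trans (normc_leD _ _) _; rewrite normc_opp complex.ComplexField.Normc.normcM nz nw; lra.
by apply: le_trans (normc_leD _ _) _; rewrite normc_opp complex.ComplexField.Normc.normcM nz nw complex.ComplexField.Normc.normc1; lra.
Qed.

Lemma cross_le x y : `|cross x y| <= normc x * normc y.
Proof.
case: x y => [a b] [c d]; rewrite /cross /= -sqrtr_sqr -sqrtrM ?addr_ge0 ?sqr_ge0 //.
rewrite ler_sqrt ?mulr_ge0 ?addr_ge0 ?sqr_ge0 // -subr_ge0.
by rewrite (_ : _ - _ = (a * c + b * d) ^+ 2) ?sqr_ge0 //; ring.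
Qed.

End Fixed.

Definition vtxf (o : option bool) (ab : R * R) : C := vtx (phase ab.1) (phase ab.2) o.

Lemma laurent_vtx o : laurent 2 (vtxf o).
Proof.
have l1 := laurent_phase1 R; have l2 := laurent_phase2 R.
have l12 : laurent 2 (fun ab : R * R => phase ab.1 * phase ab.2) by apply: (laurentM (d := 1) (e := 1)).
case: o => [[]|]; rewrite /vtxf /=.
- by apply: laurentB => //; apply: laurent_leq l1.
- by apply: laurentB => //; apply: laurent1.
exact: laurent0.
Qed.

(** Each letter raises the degree by at most 3, the degree allowed for the multiplier - z z w. *)
Lemma laurent_Phi u d (f : R * R -> C) : laurent d f ->
  laurent (3 * size u + d) (fun ab => Phi (phase ab.1) (phase ab.2) u (f ab)).
Proof.
have l1 := laurent_phase1 R; have l2 := laurent_phase2 R.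
have l12 : laurent 2 (fun ab : R * R => phase ab.1 * phase ab.2) by apply: (laurentM (d := 1) (e := 1)).
move=> lf; elim: u => [//|o u IH].
have -> : (3 * size (o :: u) + d = 3 + (3 * size u + d))%N by rewrite /= mulnS addnA.
rewrite /= /sigma; apply: laurentD; last first.
  apply: laurentM; last exact: laurent_conj.
  case: o => [[]|] /=; apply: laurentN.
  - exact: laurent_leq l12.
  - by apply: (laurentM (d := 2) (e := 1)) => //; apply: (laurentM (d := 1) (e := 1)).
  - exact: laurent_leq l1.
case: o => [[]|] /=; [exact: laurent0|exact: laurent0|].
apply: (@laurent_leq _ 2); first by lia.
apply: laurentB; last exact: laurent_leq l1.
apply: laurentD; last by apply: laurent_leq (laurent_conj l2).
by apply: laurentB => //; apply: laurent1.
Qed.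

(** Names a vertex of a strip: the number of crossings made and the label within the triangle
    reached. *)
Definition pick (m : nat) : finType := (('I_m * option bool)%type : finType).
Definition triple (m : nat) : finType :=
  ((m.-tuple (option bool)) * pick m * pick m * pick m)%type.

Definition corner m (u : m.-tuple (option bool)) (s : pick m) (ab : R * R) : C :=
  Phi (phase ab.1) (phase ab.2) (take s.1 u) (vtxf s.2 ab).

(** This is 2i times the cross product of Y - X and Z - X, written with conjugates so that it
    remains an integer Laurent polynomial in the phases. *)
Definition align m (i : triple m) (ab : R * R) : C :=
  let u := i.1.1.1 in
  let X := corner u i.1.1.2 ab in let Y := corner u i.1.2 ab in let Z := corner u i.2 ab in
  (Y - X)^*%C * (Z - X) - (Y - X) * (Z - X)^*%C.

Lemma nsq_align m (i : triple m) ab : let u := i.1.1.1 in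
  nsq (align i ab) = 4 * cross (corner u i.1.2 ab - corner u i.1.1.2 ab)
                               (corner u i.2 ab - corner u i.1.1.2 ab) ^+ 2.
Proof.
rewrite /align /=; set x := corner _ i.1.2 ab - _; set y := corner _ i.2 ab - _.
by case: x y => [a b] [c d]; rewrite /nsq /cross /=; ring.
Qed.

Lemma laurent_align m (i : triple m) : laurent (6 * m + 4) (align i).
Proof.
have lc s : laurent (3 * m + 2) (corner i.1.1.1 s).
  apply: (@laurent_leq _ (3 * size (take s.1 i.1.1.1) + 2)).
    rewrite leq_add2r leq_mul2l /= size_take_min.
    exact: leq_trans (geq_minl _ _) (ltnW (ltn_ord _)).
  by apply: laurent_Phi; apply: laurent_vtx.
have -> : (6 * m + 4 = (3 * m + 2) + (3 * m + 2))%N by lia.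
have lB r s := laurentB (lc s) (lc r).
by rewrite /align; apply: laurentB; apply: laurentM => //; apply: laurent_conj.
Qed.

(** There are 3^m words and (3m)^3 choices of three vertices, and m^3 is at most 8^m. *)
Lemma card_triple m : (#|{: triple m}| <= 27 * 24 ^ m)%N.
Proof.
rewrite /triple /pick !card_prod card_tuple card_option card_bool card_ord.
have h : (m * m * m <= 8 ^ m)%N.
  have e : (m <= 2 ^ m)%N by apply/ltnW/ltn_expl.
  by rewrite (_ : 8 = 2 * 2 * 2)%N // !expnMn !leq_mul.
have -> : (3 ^ m * (m * 3) * (m * 3) * (m * 3) = 27 * (3 ^ m * (m * m * m)))%N by ring.
by rewrite leq_mul2l /= (_ : 24 = 3 * 8)%N // expnMn leq_mul2l h orbT.
Qed.

(** The base 96 is 4 times the base 24 in the count of triples, as [ae_laurent] requires. *)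
Lemma ae_align : {ae (mu \x mu)%E, forall ab : R * R, exists m0, forall m, (m0 <= m)%N ->
  forall i : triple m, align i ab = 0 \/ (96%:R ^- m) ^+ (8 * (6 * m + 4)) <= nsq (align i ab)}.
Proof.
apply: (@ae_laurent R triple align (fun m => 6 * m + 4)%N 27 24) => //.
- exact: card_triple.
- by move=> m; lia.
by move=> m i; apply: laurent_align.
Qed.

End Unfold.

(** * Coordinates adapted to a starting vertex, and straightened trajectories *)

Section Coordinates.
Variable R : realType.
Local Notation C := R[i].
Local Notation normc := (@complex.ComplexField.Normc.normc R).
Variables z w : C.
Hypothesis z1 : z * z^*%C = 1.
Hypothesis w1 : w * w^*%C = 1.
Local Notation vtx := (vtx z w).
Local Notation Phi := (Phi z w).
Local Notation sigma := (sigma z w).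
Local Notation rot := (rot z w).

Definition side1 st : C := vtx (next st) - vtx st.
Definition side2 st : C := vtx (next (next st)) - vtx (next st).
Definition area : R := cross (side1 None) (side2 None).

Lemma cross_sides st : cross (side1 st) (side2 st) = area.
Proof.
rewrite /area /side1 /side2; case: st => [[]|] //; rewrite /next;
by move: (vtx None) (vtx (Some true)) (vtx (Some false)) => [a b] [c d] [e f]; rewrite /cross /=; ring.
Qed.

Lemma normc_ge0 (x : C) : 0 <= normc x.
Proof. by case: x => [? ?]; rewrite sqrtr_ge0. Qed.

Lemma normc_vtxB i j : normc (vtx i - vtx j) <= 4.
Proof.
apply: le_trans (normc_leD _ _) _; rewrite normc_opp.
by have := normc_vtx z1 w1 i; have := normc_vtx z1 w1 j; lra.
Qed.

Lemma area_le : `|area| <= 16.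
Proof.
apply: le_trans (cross_le _ _) _; apply: (@le_trans _ _ (4 * 4)); last by lra.
by rewrite ler_pM ?normc_ge0 ?normc_vtxB.
Qed.

Hypothesis area0 : area != 0.

(** Affine coordinates with origin at the vertex [st] and basis [side1 st], [side2 st]. The other
    vertices become (1, 0) and (1, 1), and the ray that cuts the opposite side in ratio x gets slope
    x. *)
Definition coord st (X : C) : R * R :=
  (cross (X - vtx st) (side2 st) / area, cross (side1 st) (X - vtx st) / area).

Lemma coordB st X Y :
  (coord st Y).1 - (coord st X).1 = cross (Y - X) (side2 st) / area /\
  (coord st Y).2 - (coord st X).2 = cross (side1 st) (Y - X) / area.
Proof.
rewrite /coord /= -!mulrBl; split; congr (_ / _);
by case: X Y (vtx st) (side2 st) (side1 st) => [? ?] [? ?] [? ?] [? ?] [? ?]; rewrite /cross /=; ring.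
Qed.

Lemma det3_coord st X Y Z :
  det3 (coord st X) (coord st Y) (coord st Z) = cross (Y - X) (Z - X) / area.
Proof.
rewrite /det3; have [-> ->] := coordB st X Y; have [-> ->] := coordB st X Z.
have h : cross (Y - X) (side2 st) * cross (side1 st) (Z - X)
   - cross (side1 st) (Y - X) * cross (Z - X) (side2 st) = cross (Y - X) (Z - X) * area.
  rewrite -(cross_sides st); move: (Y - X) (Z - X) (side1 st) (side2 st).
  by move=> [? ?] [? ?] [? ?] [? ?]; rewrite /cross /=; ring.
rewrite mulrACA [X in _ - X]mulrACA -mulrBl h.
by field.
Qed.

Lemma coord_inj st : injective (coord st).
Proof.
move=> X Y e; have [] := coordB st Y X; rewrite e !subrr.
move=> /esym/eqP; rewrite mulf_eq0 invr_eq0 (negbTE area0) orbF => /eqP h1.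
move=> /esym/eqP; rewrite mulf_eq0 invr_eq0 (negbTE area0) orbF => /eqP h2.
apply/eqP; rewrite -subr_eq0; move: h1 h2 (area0); rewrite -(cross_sides st).
case: (X - Y) (side1 st) (side2 st) => [p q] [a b] [c d]; rewrite /cross /= => h1 h2 nz.
rewrite eq_complex /= -(mulrI_eq0 _ (lregP nz)) -(mulrI_eq0 q (lregP nz)).
have -> : (a * d - b * c) * p = a * (p * d - q * c) + c * (a * q - b * p) by ring.
have -> : (a * d - b * c) * q = b * (p * d - q * c) + d * (a * q - b * p) by ring.
by rewrite h1 h2 !mulr0 addr0 eqxx.
Qed.

Lemma coord_between st P Q (t : R) : 0 < t -> t < 1 ->
  between (coord st P) (coord st Q) (coord st (P + t%:C%C * (Q - P))).
Proof.
move=> t0 t1; exists t; split=> //; apply/eqP; rewrite -subr_eq0 /coord /=.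
all: case: P Q (vtx st) (side2 st) (side1 st) => [? ?] [? ?] [? ?] [? ?] [? ?].
all: by rewrite /cross /=; apply/eqP; field.
Qed.

Lemma coord_ray st (x l : R) : coord st (vtx st + l%:C%C * (side1 st + x%:C%C * side2 st)) = (l, x * l).
Proof.
rewrite /coord addrC addKr; have := area0; rewrite -(cross_sides st) => nz.
move: nz; case: (side1 st) (side2 st) => [a b] [c d]; rewrite /cross /= => nz.
by congr (_, _); field.
Qed.

Definition V st (u : seq (option bool)) (i : option bool) : R * R := coord st (Phi u (vtx i)).

Lemma V_step st u o i : i != o -> V st (rcons u o) i = V st u i.
Proof. by move=> ne; rewrite /V Phi_rcons sigma_vtx. Qed.

Lemma V_base st i : i != st -> V st [::] i = (1, 0) \/ V st [::] i = (1, 1).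
Proof.
case/next_other => ->; rewrite /V /=; [left|right].
  transitivity ((1, 0 * 1) : R * R); last by rewrite mul0r.
  rewrite -(coord_ray st 0 1); congr (coord _ _).
  by rewrite /side1 rmorph1 rmorph0 mul0r addr0 mul1r addrC subrK.
transitivity ((1, 1 * 1) : R * R); last by rewrite mulr1.
rewrite -(coord_ray st 1 1); congr (coord _ _).
by rewrite /side1 /side2 rmorph1 !mul1r; ring.
Qed.

(** Reflections preserve area up to sign and the coordinates normalise it to 1; moduli grow at most
    linearly with the number of reflections by [normc_Phi]. *)
Lemma tame_V st u (n : nat) : (size u <= n)%N -> tame (V st) ((16 * n.+1)%:R / `|area|) u.
Proof.
move=> un t tu; have A0 : 0 < `|area| by rewrite normr_gt0.
split=> [i|i j k ij ik jk].
  rewrite /V /coord /= normrM normfV ler_pM2r ?invr_gt0 //.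
  apply: le_trans (cross_le _ _) _.
  (* The reflections account for 4 n and the two vertices for 2 each. *)
  have le1 : normc (Phi (take t u) (vtx i) - vtx st) <= 4 * (n.+1)%:R.
    apply: le_trans (normc_leD _ _) _; rewrite normc_opp.
    have := normc_Phi z1 w1 (take t u) (vtx i).
    have := normc_vtx z1 w1 i; have := normc_vtx z1 w1 st.
    have : (size (take t u))%:R <= n%:R :> R.
      by rewrite ler_nat size_take_min; apply: leq_trans (geq_minr _ _) un.
    by rewrite -[n.+1]addn1 natrD; lra.
  rewrite (_ : (16 * n.+1)%:R = 4 * (n.+1)%:R * 4); last by rewrite natrM; ring.
  by rewrite ler_pM ?normc_ge0 ?normc_vtxB.
rewrite /V det3_coord cross_Phi //.
have sq (q c d : R) : q ^+ 2 = 1 -> (q * c / d) ^+ 2 = c ^+ 2 / d ^+ 2.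
  by move=> h; rewrite expr_div_n exprMn h mul1r.
rewrite sq ?sqrr_sign //.
have -> : cross (vtx j - vtx i) (vtx k - vtx i) ^+ 2 = area ^+ 2.
  have ar : cross (vtx (next i) - vtx i) (vtx (next (next i)) - vtx i) = area.
    rewrite -(cross_sides i) /side1 /side2; move: (vtx i) (vtx (next i)) (vtx (next (next i))) => [? ?] [? ?] [? ?].
    by rewrite /cross /=; ring.
  have anti (x y : C) : cross x y = - cross y x by rewrite /cross; ring.
  rewrite -ar; rewrite eq_sym in ij; rewrite eq_sym in ik.
  case: (next_other ij) jk => ->; case: (next_other ik) => -> //; rewrite ?eqxx // => _.
  by rewrite anti sqrrN.
by rewrite divff // sqrf_eq0.
Qed.

Section Trajectory.
Variables (st : option bool) (u : seq (option bool)) (P : nat -> C) (l : nat -> R) (x : R).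
Hypothesis u0 : (0 < size u)%N.
Hypothesis ust : nth None u 0 = st.
Hypothesis u_step : forall t, (t.+1 < size u)%N -> nth None u t != nth None u t.+1.
Hypothesis x0 : 0 < x.
Hypothesis x1 : x < 1.
Hypothesis P0 : P 0 = vtx st.
Hypothesis P1 : P 1 = vtx (next st) + x%:C%C * (vtx (next (next st)) - vtx (next st)).
Hypothesis on_side : forall t, (t < size u)%N -> exists c : R, [/\ 0 < c, c < 1 &
  P t.+1 = vtx (next (nth None u t)) +
    c%:C%C * (vtx (next (next (nth None u t))) - vtx (next (nth None u t)))].
Hypothesis l0 : forall t, (t < size u)%N -> 0 < l t.
Hypothesis reflection : forall t, (t < size u)%N ->
  P t.+2 - P t.+1 = (l t)%:C%C * (rot (nth None u t) * (P t.+1 - P t)^*%C).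

(** By the reflection law each segment is [l t] times the reflected previous one. So [del t] is the
    length of segment t relative to the first, and [travel t] is the position of [P t.+1] along the
    unfolded ray. *)
Let del t := \prod_(i < t) l i.
Definition travel t : R := \sum_(i < t.+1) del i.

Lemma next_neq o : next o != o /\ next (next o) != o. Proof. by case: o => [[]|]. Qed.

Let sigma_fix t : (t < size u)%N -> sigma (nth None u t) (P t.+1) = P t.+1.
Proof.
move=> /on_side[c [_ _ ->]]; set o := nth None u t.
have [n1 n2] := next_neq o.
have s1 := sigma_vtx z1 w1 n1; have s2 := sigma_vtx z1 w1 n2.
set p := vtx (next o) in s1 *; set q := vtx (next (next o)) in s2 *.
have := sigmaB z w o (p + c%:C%C * (q - p)) p.
have -> : p + c%:C%C * (q - p) - p = c%:C%C * (q - p) by rewrite addrC addKr.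
rewrite s1 conj_scale mulrCA -sigmaB s1 s2 => /eqP.
by rewrite subr_eq addrC => /eqP.
Qed.

(** [sigma] undoes the reflection law, so each unfolded segment continues the previous one in the
    same direction. *)
Let unfold_diff t : (t <= size u)%N -> Phi (take t u) (P t.+1) - Phi (take t u) (P t) =
  (del t)%:C%C * (P 1 - P 0).
Proof.
elim: t => [|t IH] lt; first by rewrite take0 /del big_ord0 rmorph1 mul1r.
rewrite (take_nth None) // !Phi_rcons.
have e : sigma (nth None u t) (P t.+2) - sigma (nth None u t) (P t.+1) =
    (l t)%:C%C * (P t.+1 - P t).
  rewrite sigmaB reflection // conj_scale mulrCA; congr (_ * _).
  by rewrite rmorphM /= conjcK mulrA rot_unit // mul1r.
rewrite (Phi_scale z w (take t u) e) IH; last exact: ltnW.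
by rewrite /del big_ord_recr /= rmorphM /=; ring.
Qed.

Let side_dir : P 1 - P 0 = side1 st + x%:C%C * side2 st.
Proof. by rewrite P1 P0 /side1 /side2; ring. Qed.

Lemma travelE t : (t <= size u)%N -> coord st (Phi (take t u) (P t.+1)) = (travel t, x * travel t).
Proof.
move=> lt; rewrite -(coord_ray st); congr (coord _ _); rewrite -side_dir.
elim: t lt => [|t IH] lt.
  by rewrite take0 /travel big_ord1 /del big_ord0 rmorph1 mul1r P0 addrC subrK.
have := unfold_diff lt; rewrite {2}(take_nth None) // Phi_rcons sigma_fix // IH; last exact: ltnW.
move/eqP; rewrite subr_eq => /eqP ->.
by rewrite /travel [in RHS]big_ord_recr /= rmorphD /=; ring.
Qed.

Let del0 t : (t <= size u)%N -> 0 < del t.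
Proof. by move=> lt; apply: prodr_gt0 => i _; apply: l0; apply: leq_trans lt. Qed.

Lemma travel0 t : (t <= size u)%N -> 0 < travel t.
Proof.
elim: t => [|t IH] lt; first by rewrite /travel big_ord1 del0.
by rewrite /travel big_ord_recr /= addr_gt0 ?del0 //; apply/IH/ltnW.
Qed.

Lemma trajectory_ray : ray (V st) st u x travel.
Proof.
split=> //.
- move=> t lt; split=> [|lt']; first by apply: travel0; apply: ltnW.
  by rewrite /travel [X in _ < X]big_ord_recr /= ltrDl del0.
move=> t i j lt ij iu ju.
rewrite -(travelE (ltnW lt)); have [c [c0 c1 ->]] := on_side lt.
set o := nth None u t in iu ju *.
have eP p q : Phi (take t u) (p + c%:C%C * (q - p)) =
   Phi (take t u) p + c%:C%C * (Phi (take t u) q - Phi (take t u) p).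
  have := @Phi_scale _ z w (take t u) (p + c%:C%C * (q - p)) p q p c.
  rewrite addrC addKr => /(_ erefl)/eqP; rewrite subr_eq => /eqP ->.
  exact: addrC.
rewrite eP; have b := coord_between st (Phi (take t u) (vtx (next o)))
  (Phi (take t u) (vtx (next (next o)))) c0 c1.
case: (next_other iu) ij => ->; case: (next_other ju) => ->; rewrite ?eqxx // => _.
case: b => d [d0 d1 e1 e2]; exists (1 - d); split; [lra|lra| |].
  by rewrite e1; ring.
by rewrite e2; ring.
Qed.

End Trajectory.

(** The common last point determines its parameter and the slope x; word and slope then determine
    every crossing by [ray_unique]. *)
Lemma ray_points_unique st u x x' p p' (P P' : nat -> C) :
  ray (V st) st u x p -> ray (V st) st u x' p' ->
  (0 < size u)%N -> 0 < p (size u) ->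
  (forall t, (t <= size u)%N -> coord st (Phi (take t u) (P t.+1)) = (p t, x * p t)) ->
  (forall t, (t <= size u)%N -> coord st (Phi (take t u) (P' t.+1)) = (p' t, x' * p' t)) ->
  P (size u).+1 = P' (size u).+1 ->
  forall t, (t <= size u)%N -> P t.+1 = P' t.+1.
Proof.
move=> r r' u0 pp c c' e t le.
have [ep ex] : p (size u) = p' (size u) /\ x = x'.
  have := c _ (leqnn _); rewrite e c' // => -[e1 e2]; split=> //.
  by move: e2; rewrite e1 => /(mulIf (lt0r_neq0 pp)).
have [->|ne] := eqVneq t (size u); first by [].
have lt : (t < size u)%N by rewrite ltn_neqAle ne.
rewrite -ex in r' c'.
apply/(Phi_inj z1 w1 (u := take t u))/(@coord_inj st).
by rewrite c // c' // (ray_unique (@V_step st) (@V_base st) r r').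
Qed.

End Coordinates.

(** * Unfolding a generalized diagonal *)

Section Triangle.
Variable R : realType.
Local Notation C := R[i].
Variables a b : R.
Hypothesis a0 : 0 < a.
Hypothesis b0 : 0 < b.
Hypothesis ab : a + b < pi.
Local Notation z := (phase a).
Local Notation w := (phase b).

(** Since z w - 1 = 2i sin(a + b) e^(i(a + b)), this factor clears the denominator sin(a + b) in
    [vC]. *)
Definition scale : C := z * w - 1.
Definition emb (P : R * R) : C := scale * (P.1 +i* P.2)%C.

Definition vertex (o : option bool) : R * R :=
  match o with None => vA R | Some false => vB R | Some true => vC a b end.

Lemma sin_sum_gt0 : 0 < sin (a + b).
Proof. by apply: sin_gt0_pi; rewrite addr_gt0. Qed.

Lemma emb_vertex o : emb (vertex o) = vtx z w o.
Proof.
have s0 : sin (a + b) != 0 by rewrite gt_eqF // sin_sum_gt0.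
case: o => [[]|]; rewrite /emb /vertex /vtx /scale.
- rewrite /vC /=; set t := sin b / _.
  have e : t * sin (a + b) = sin b by rewrite /t divfK.
  have eC : z * w - 1 = (2 * sin (a + b))%:C%C * (- sin (a + b) +i* cos (a + b))%C.
    apply/eqP; rewrite eq_complex /phase /= !sinD !cosD.
    have ha := cos2Dsin2 a; have hb := cos2Dsin2 b.
    have ha2 : cos a ^+ 2 = 1 - sin a ^+ 2 by lra.
    have hb2 : cos b ^+ 2 = 1 - sin b ^+ 2 by lra.
    by apply/andP; split; apply/eqP; ring: ha2 hb2.
  rewrite eC.
  have -> : (2 * sin (a + b))%:C%C * (- sin (a + b) +i* cos (a + b))%C * (t * cos a +i* (t * sin a))%C
     = (2 * (t * sin (a + b)))%:C%C * ((- sin (a + b) +i* cos (a + b))%C * (cos a +i* sin a)%C).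
    by apply/eqP; rewrite eq_complex /=; apply/andP; split; apply/eqP; ring.
  rewrite e; apply/eqP; rewrite eq_complex /phase /= !sinD !cosD.
  have hb2 : cos b ^+ 2 = 1 - sin b ^+ 2 by have hb := cos2Dsin2 b; lra.
  by apply/andP; split; apply/eqP; ring: hb2.
- by rewrite /vB /= (_ : (1 +i* 0)%C = 1) // mulr1.
by rewrite /vA /= (_ : (0 +i* 0)%C = 0) // mulr0.
Qed.

Lemma scale_neq0 : scale != 0.
Proof.
have e : scale = phase (a + b) - phase 0.
  rewrite /scale /phase; apply/eqP; rewrite eq_complex /= addr0 sin0 cos0.
  have -> : a + b + (a + b) = (a + a) + (b + b) by ring.
  by rewrite (sinD (a + a)) (cosD (a + a)); apply/andP; split; apply/eqP; ring.
rewrite -nsq_eq0 e nsq_phaseB subr0 mulf_neq0 // ?pnatr_eq0 //.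
by rewrite expf_neq0 // gt_eqF // sin_sum_gt0.
Qed.

Lemma emb_inj : injective emb.
Proof. by move=> [p q] [p' q'] /(mulfI scale_neq0) [-> ->]. Qed.

Lemma emb_psub P Q : emb (psub P Q) = emb P - emb Q.
Proof. by rewrite /emb -mulrBr. Qed.

Lemma emb_pscale t P : emb (pscale t P) = t%:C%C * emb P.
Proof.
rewrite /emb mulrCA; congr (_ * _); apply/eqP; rewrite eq_complex /=.
by apply/andP; split; apply/eqP; ring.
Qed.

Lemma emb_segment t P Q : emb (padd P (pscale t (psub Q P))) = emb P + t%:C%C * (emb Q - emb P).
Proof. by rewrite -emb_psub -emb_pscale /emb -mulrDr. Qed.

Lemma area_neq0 : area z w != 0.
Proof.
have h (x y : C) : cross (scale * x) (scale * y) = nsq scale * cross x y.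
  by case: scale x y => [? ?] [? ?] [? ?]; rewrite /cross /nsq /=; ring.
rewrite /area /side1 /side2 -!emb_vertex /next /vertex -!emb_psub /emb h mulf_neq0 //.
  by rewrite nsq_eq0 scale_neq0.
rewrite /cross /vA /vB /vC /=.
have -> : (1 - 0) * (sin b / sin (a + b) * sin a - 0) -
  (0 - 0) * (sin b / sin (a + b) * cos a - 1) = sin b / sin (a + b) * sin a by ring.
have sa : 0 < sin a by apply: sin_gt0_pi; rewrite a0 (lt_trans _ ab) // ltrDl.
have sb : 0 < sin b by apply: sin_gt0_pi; rewrite b0 (lt_trans _ ab) // ltrDr.
by rewrite gt_eqF // mulr_gt0 // divr_gt0 // sin_sum_gt0.
Qed.

Lemma side2_neq0 o : side2 z w o != 0.
Proof.
apply: contra_neq area_neq0 => e; rewrite -(cross_sides z w o) e /cross /=; ring.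
Qed.

(** The reflection fixes both ends of the side, so [rot] times the conjugate of the side vector is
    the side vector. Multiplying by this nonzero conjugate reduces the claim to the formula of
    [reflect_dir]. *)
Lemma emb_reflect o u : let d := psub (vertex (next (next o))) (vertex (next o)) in
  emb (reflect_dir d u) = rot z w o * (emb u)^*%C.
Proof.
move=> d; have eD : emb d = side2 z w o by rewrite emb_psub !emb_vertex.
have fixD : rot z w o * (emb d)^*%C = emb d.
  have [n1 n2] := next_neq o.
  by rewrite eD /side2 -sigmaB !sigma_vtx // phaseJ.
have D0 : emb d != 0 by rewrite eD side2_neq0.
have dd : pdot d d != 0.
  apply: contra_neq D0; rewrite /pdot /emb => /eqP.
  rewrite -!expr2 paddr_eq0 ?sqr_ge0 // !sqrf_eq0 => /andP[/eqP -> /eqP ->].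
  by rewrite (_ : (0 +i* 0)%C = 0) // mulr0.
have cD0 : (emb d)^*%C != 0 by rewrite conjc_eq0.
apply: (mulIf cD0); rewrite [RHS]mulrAC fixD.
have h : ((reflect_dir d u).1 +i* (reflect_dir d u).2)%C * (d.1 +i* d.2)^*%C =
   (d.1 +i* d.2)%C * (u.1 +i* u.2)^*%C.
  move: dd; case: d {eD fixD D0 cD0} u => [d1 d2] [u1 u2]; rewrite /reflect_dir /pdot /psub /pscale /= => dd.
  by apply/eqP; rewrite eq_complex /=; apply/andP; split; apply/eqP; field.
rewrite /emb !rmorphM /= -!/(conjc _).
rewrite mulrACA [X in _ = X]mulrACA; congr (_ * _); exact: h.
Qed.

Lemma sidesP P Q : (P, Q) \in sides a b ->
  exists o, P = vertex (next o) /\ Q = vertex (next (next o)).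
Proof.
rewrite !inE => /or3P[] /eqP[-> ->]; [exists (Some true) | exists None | exists (Some false)] => //.
Qed.

Lemma mem_sides o : (vertex (next o), vertex (next (next o))) \in sides a b.
Proof. by rewrite !inE; case: o => [[]|]; rewrite eqxx ?orbT. Qed.

Lemma verticesP P : P \in vertices a b -> exists o, P = vertex o.
Proof.
by rewrite !inE => /or3P[] /eqP ->; [exists None | exists (Some false) | exists (Some true)].
Qed.

Lemma padd_psub (t : R) (P Q : R * R) : padd P (pscale t (psub Q P)) =
  ((1 - t) * P.1 + t * Q.1, (1 - t) * P.2 + t * Q.2).
Proof. by rewrite /padd /pscale /psub /=; congr (_, _); ring. Qed.

Lemma vertex_on_side i o : i != o ->
  on_closed_seg (vertex (next o)) (vertex (next (next o))) (vertex i).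
Proof.
case/next_other => ->; [exists 0 | exists 1]; rewrite padd_psub lexx ler01; split=> //; split=> //.
  by rewrite subr0 !mul1r !mul0r !addr0; case: (vertex _).
by rewrite subrr !mul1r !mul0r !add0r; case: (vertex _).
Qed.

Lemma open_closed (P Q X : R * R) : on_open_seg P Q X -> on_closed_seg P Q X.
Proof. by move=> [t [h1 [h2 h3]]]; exists t; rewrite !ltW. Qed.

(** There is one letter per reflection. A diagonal ends at the vertex opposite to the side hit last,
    so its end is read off the word. *)
Definition unfolds (s : seq (R * R)) st u x p : Prop :=
  [/\ ray (V z w st) st u x p, size s = (size u).+2, (0 < size u)%N,
      (forall t, (t <= size u)%N ->
        0 < p t /\ coord z w st (Phi z w (take t u) (emb (nth (vA R) s t.+1))) = (p t, x * p t)) &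
      nth (vA R) s 0 = vertex st /\ nth (vA R) s (size u).+1 = vertex (nth None u (size u).-1)].

(** That no segment runs along a side yields all the combinatorics: there is at least one
    reflection, consecutive letters differ, and the first and last letters are the end vertices. *)
Lemma gen_diag_unfolds s : gen_diag a b s -> exists st u x p, unfolds s st u x p.
Proof.
move=> [sz [hd [tl [refl seg]]]].
pose P i := nth (vA R) s i; set k := (size s - 2)%N.
have sk : size s = k.+2 by rewrite /k; case: (s) sz => [|? []] //= ? ? _; lia.
have [st est] : exists st, P 0%N = vertex st.
  by apply: verticesP; rewrite /P nth0; exact: hd.
have [en een] : exists en, P k.+1 = vertex en.
  by apply: verticesP; move: tl; rewrite (last_nth (vA R)) sk.
have noside o i : (i.+1 < size s)%N ->
    on_closed_seg (vertex (next o)) (vertex (next (next o))) (P i) ->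
    on_closed_seg (vertex (next o)) (vertex (next (next o))) (P i.+1) -> False.
  move=> lt h1 h2; apply: (seg i lt); exists (vertex (next o)), (vertex (next (next o))).
  by split; [exact: mem_sides |].
have kpos : (0 < k)%N.
  rewrite lt0n; apply/negP => /eqP ke; rewrite ke in een.
  have [q [q1 q2]] : exists q, st != q /\ en != q.
    by case: (st) (en) => [[]|] [[]|]; (exists None; done) || (exists (Some true); done) || (exists (Some false); done).
  apply: (noside q 0%N); first by rewrite sk.
    by rewrite est; apply: vertex_on_side.
  by rewrite een; apply: vertex_on_side.
have ex t : exists ol : option bool * R, (t < k)%N -> [/\
    on_open_seg (vertex (next ol.1)) (vertex (next (next ol.1))) (P t.+1), 0 < ol.2 &
    emb (P t.+2) - emb (P t.+1) = ol.2%:C%C * (rot z w ol.1 * (emb (P t.+1) - emb (P t))^*%C)].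
  case: (ltnP t k) => lt; last by exists (None, 0).
  have szt : (t.+2 < size s)%N by rewrite sk !ltnS.
  have [A [B [/sidesP[q [-> ->]] [op [l [l0 e]]]]]] := refl t.+1 isT szt.
  have h : emb (P t.+2) - emb (P t.+1) =
      l%:C%C * (rot z w q * (emb (P t.+1) - emb (P t))^*%C).
    by rewrite -!emb_psub [psub (P t.+2) _]e emb_pscale emb_reflect.
  by exists (q, l) => _; split; [exact: op | exact: l0 | exact: h].
have [ol olP] := boolp.choice ex.
pose u := mkseq (fun t => (ol t).1) k; have su : size u = k by rewrite size_mkseq.
have nu t : (t < k)%N -> nth None u t = (ol t).1 by move=> lt; rewrite nth_mkseq.
have onu t : (t < k)%N -> on_open_seg (vertex (next (nth None u t)))
    (vertex (next (next (nth None u t)))) (P t.+1) by move=> lt; rewrite nu //; have [] := olP t lt.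
have ust : nth None u 0 = st.
  apply/eqP; rewrite eq_sym; apply/negP => /negP ne; apply: (noside (nth None u 0) 0%N).
  - by rewrite sk.
  - by rewrite est; apply: vertex_on_side.
  - exact/open_closed/onu.
have uen : nth None u k.-1 = en.
  have lt : (k.-1 < k)%N by rewrite prednK.
  apply/eqP; rewrite eq_sym; apply/negP => /negP ne; apply: (noside (nth None u k.-1) k).
  - by rewrite sk.
  - by have := onu _ lt; rewrite prednK // => /open_closed.
  - by rewrite een; apply: vertex_on_side.
have ustep t : (t.+1 < size u)%N -> nth None u t != nth None u t.+1.
  rewrite su => lt; apply/negP => /eqP e; apply: (noside (nth None u t) t.+1).
  - by rewrite sk ltnS ltnS ltnW.
  - exact/open_closed/onu/ltnW.
  - by rewrite e; apply/open_closed/onu.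
have [x [x0 [x1 ex1]]] := onu 0%N kpos; rewrite ust in ex1.
pose E i := emb (P i).
have E0 : E 0%N = vtx z w st by rewrite /E est emb_vertex.
have E1 : E 1%N = vtx z w (next st) + x%:C%C * (vtx z w (next (next st)) - vtx z w (next st)).
  by rewrite /E ex1 emb_segment !emb_vertex.
have Eside t : (t < size u)%N -> exists c : R, [/\ 0 < c, c < 1 &
  E t.+1 = vtx z w (next (nth None u t)) +
    c%:C%C * (vtx z w (next (next (nth None u t))) - vtx z w (next (nth None u t)))].
  rewrite su => /onu[c [c0 [c1 ec]]]; exists c; split=> //.
  by rewrite /E ec emb_segment !emb_vertex.
have l0 t : (t < size u)%N -> 0 < (ol t).2 by rewrite su => /olP[].
have Erefl t : (t < size u)%N ->
    E t.+2 - E t.+1 = ((ol t).2)%:C%C * (rot z w (nth None u t) * (E t.+1 - E t)^*%C).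
  by rewrite su => lt; rewrite nu //; have [] := olP t lt.
have u0 : (0 < size u)%N by rewrite su.
have zJ := phaseJ a; have wJ := phaseJ b.
exists st, u, x, (travel (fun t => (ol t).2)); split=> //.
- exact: (trajectory_ray zJ wJ area_neq0 ust ustep x0 x1 E0 E1 Eside l0 Erefl).
- by rewrite su.
- move=> t lt; split; first exact: (travel0 (u := u)).
  exact: (travelE zJ wJ area_neq0 E0 E1 Eside Erefl lt).
by rewrite -/(P 0%N) est su -/(P k.+1) een uen.
Qed.

Lemma unfolds_unique s s' st u x x' p p' :
  unfolds s st u x p -> unfolds s' st u x' p' -> s = s'.
Proof.
move=> [r sz u0 h [h0 h1]] [r' sz' _ h' [h0' h1']].
apply: (@eq_from_nth _ (vA R)) => [|i]; first by rewrite sz sz'.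
rewrite sz; case: i => [|i] lt; first by rewrite h0 h0'.
apply: emb_inj.
apply: (ray_points_unique (phaseJ a) (phaseJ b) area_neq0 r r' u0 (P := fun i => emb (nth _ s i))
  (P' := fun i => emb (nth _ s' i)) _ (fun t ht => (h t ht).2) (fun t ht => (h' t ht).2)) => //.
- by have [] := h _ (leqnn _).
- by rewrite h1 h1'.
Qed.

End Triangle.

(** * The exponent *)

(* starting vertices, lengths, cells of initial directions, words within a cell *)
Definition diag_bound (m : nat) : nat :=
  (3 * ((m ^ 3).+1 * (96 ^ (41 * m ^ 2) * m.*2.+1 ^ (m ^ 2))))%N.

Lemma cube_lt_exp m : ((m ^ 3).+1 <= 8 ^ m)%N.
Proof.
have e : (m < 2 ^ m)%N by apply: ltn_expl.
apply: (@leq_trans (m.+1 ^ 3)); last by rewrite (_ : 8 = 2 ^ 3)%N // -expnM mulnC expnM leq_exp2r.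
by rewrite !expnS !expn0 !muln1; nia.
Qed.

Section Growth.
Variable R : realType.

Lemma diag_bound_nat m : (0 < m)%N ->
  (3 * ((m ^ 3).+1 * 96 ^ (41 * m ^ 2)) <= 96 ^ (43 * m ^ 2))%N.
Proof.
(* One extra m^2 in the exponent absorbs the factor 3 and another the factor m^3 + 1. *)
move=> m0; rewrite (_ : 43 = 1 + (1 + 41))%N // !mulnDl !mul1n !expnD.
apply: leq_mul.
  by apply: (@leq_trans (96 ^ 1)) => //; rewrite leq_exp2l // expn_gt0 m0.
apply: leq_mul => //; apply: leq_trans (cube_lt_exp m) _.
apply: (@leq_trans (96 ^ m)); first by rewrite leq_exp2r.
by rewrite leq_exp2l // -{1}(expn1 m) leq_pexp2l.
Qed.

(** By 1 + y <= e^y, 96 is at most e^95 and u is at most e^u. A bound u for the eighth root of 2m +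
    1 thus takes the place of a logarithm. *)
Lemma diag_bound_exp : exists2 K : R, 0 <= K & forall m (u : R), (0 < m)%N ->
  0 <= u -> (m.*2.+1)%:R <= u ^+ 8 -> (diag_bound m)%:R <= expR (m%:R ^+ 2 * (K + 8 * u)).
Proof.
exists (95 *+ 43) => [|m u m0 u0 le]; first by rewrite mulrn_wge0.
rewrite /diag_bound 2!mulnA -(mulnA 3) natrM mulrDr expRD; apply: ler_pM => //.
  apply: (@le_trans _ _ ((96 ^ (43 * m ^ 2))%:R)); first by rewrite ler_nat diag_bound_nat.
  have -> : m%:R ^+ 2 * (95 *+ 43) = (43 * m ^ 2)%:R * 95 :> R.
    by rewrite natrM natrX -[95 *+ 43]mulr_natl mulrA [m%:R ^+ 2 * _]mulrC.
  rewrite natrX.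
  rewrite expRM_natl lerXn2r ?nnegrE ?expR_ge0 ?ler0n //.
  by have := expR_ge1Dx (95 : R); clear; lra.
rewrite -[in leRHS]natrX expRM_natl natrX.
rewrite lerXn2r ?nnegrE ?expR_ge0 ?ler0n //; apply: le_trans le _.
rewrite expRM_natl lerXn2r ?nnegrE ?expR_ge0 //.
by apply: le_trans (expR_ge1Dx u); rewrite lerDr.
Qed.

(** With v = n^(1/48), m is of order v^16 and u of order v^2, so the exponent m^2 (K + 8 u) is of
    order v^34. One more power of v absorbs the constants, and v^35 = n^(35/48) is small enough
    because 83/48 <= sqrt 3. *)
Lemma growth (m1 : nat) (eps : R) : 0 < eps -> exists C : R, 0 < C /\
  forall n : nat, (1 <= n)%N -> exists m, [/\ (m1 <= m)%N, (n <= m ^ 3)%N &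
    (diag_bound m)%:R < C * expR (n%:R `^ (Num.sqrt 3 - 1 + eps))].
Proof.
move=> eps0; have [K K0 boundK] := diag_bound_exp.
pose M : R := (maxn m1 2)%:R; pose c : R := M ^+ 2 * (K + 24 * M).
exists (expR (c ^+ 35 + 1)); split; first exact: expR_gt0.
move=> n n1; pose v : R := n%:R `^ (48^-1).
have vX k : v ^+ k = n%:R `^ (k%:R / 48).
  by rewrite /v -powR_mulrn ?powR_ge0 // -powRrM mulrC.
have v48 : v ^+ 48 = n%:R by rewrite vX divff // powRr1 ?ler0n.
have v1 : 1 <= v by rewrite -(@ler_pXn2r _ 48) ?nnegrE ?powR_ge0 // expr1n v48 ler1n.
have v0 : 0 <= v by apply: le_trans v1.
have M2 : 2 <= M by rewrite /M ler_nat leq_maxr.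
have M0 : 0 <= M by apply: le_trans M2.
pose m := maxn m1 (Num.trunc (v ^+ 16)).+1.
have v16 : 1 <= v ^+ 16 by rewrite exprn_ege1.
have /truncn_itv/andP[t1 t2] : 0 <= v ^+ 16 by apply: le_trans v16.
have lm : v ^+ 16 <= m%:R.
  by apply: le_trans (ltW t2) _; rewrite ler_nat leq_maxr.
have um : m%:R <= M * v ^+ 16.
  rewrite /m natr_max ge_max; apply/andP; split.
    apply: (@le_trans _ _ M); first by rewrite /M ler_nat leq_maxl.
    by rewrite ler_peMr.
  rewrite -natr1; apply: (@le_trans _ _ (v ^+ 16 + v ^+ 16)); first exact: lerD.
  by rewrite -mulr2n -mulr_natl ler_wpM2r // (le_trans _ v16).
have m0 : (0 < m)%N by rewrite /m leq_max orbT.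
exists m; split; first exact: leq_maxl.
  rewrite -(ler_nat R) natrX -v48 (_ : 48 = 16 * 3)%N // exprM.
  by rewrite lerXn2r ?nnegrE ?ler0n // (le_trans _ v16).
have M1 : 1 <= M by apply: le_trans M2; rewrite ler1n.
have M31 : 1 <= 3 * M by apply: le_trans M1 _; rewrite ler_peMl // ler1n.
have M30 : 0 <= 3 * M by rewrite mulr_ge0.
have v2 : 1 <= v ^+ 2 by rewrite exprn_ege1.
have u1 : 1 <= 3 * M * v ^+ 2.
  by apply: (@le_trans _ _ (3 * M)); [exact: M31 | rewrite ler_peMr].
have b3 : (diag_bound m)%:R <= expR (c * v ^+ 34).
  have u8 : (m.*2.+1)%:R <= (3 * M * v ^+ 2) ^+ 8.
    apply: (@le_trans _ _ (3 * m%:R)).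
      by rewrite -natrM ler_nat mulSn mul2n -add1n leq_add2r.
    apply: (@le_trans _ _ (3 * M * v ^+ 16)); first by rewrite -mulrA ler_wpM2l.
    rewrite exprMn -[(v ^+ 2) ^+ 8]exprM ler_wpM2r //; first by rewrite (le_trans _ v16).
    by rewrite ler_eXnr.
  apply: le_trans (boundK m _ m0 (le_trans ler01 u1) u8) _; rewrite ler_expR.
  have mm : m%:R ^+ 2 <= M ^+ 2 * v ^+ 32.
    rewrite (_ : 32 = 16 * 2)%N // exprM -exprMn lerXn2r ?nnegrE ?ler0n //.
    by rewrite mulr_ge0 // (le_trans _ v16).
  have -> : c * v ^+ 34 = (M ^+ 2 * v ^+ 32) * ((K + 24 * M) * v ^+ 2).
    by rewrite /c (exprD v 2 32) [RHS]mulrACA; congr (_ * _); rewrite mulrC.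
  apply: ler_pM => //.
    by rewrite addr_ge0 // mulr_ge0 // (le_trans ler01 u1).
  rewrite [leRHS]mulrDl; apply: lerD; first by rewrite ler_peMr.
  by rewrite !mulrA -natrM.
apply: le_lt_trans b3 _; rewrite -expRD ltr_expR.
have c0 : 0 <= c by rewrite /c mulr_ge0 ?sqr_ge0 // addr_ge0 // mulr_ge0.
(* The constant is absorbed by another power of v when c <= v; otherwise v is below c. *)
have h1 : c * v ^+ 34 <= v ^+ 35 + c ^+ 35.
  have [le|lt] := leP c v.
    apply: (@le_trans _ _ (v ^+ 35)); last by rewrite lerDl exprn_ge0.
    by rewrite [leRHS]exprS ler_wpM2r // exprn_ge0.
  apply: (@le_trans _ _ (c ^+ 35)); last by rewrite lerDr exprn_ge0.
  by rewrite [leRHS]exprS ler_wpM2l // lerXn2r ?nnegrE // ltW.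
have h2 : v ^+ 35 <= n%:R `^ (Num.sqrt 3 - 1 + eps).
  rewrite vX; apply: ler_powR; first by rewrite ler1n.
  have h : 83 / 48 <= Num.sqrt 3 :> R.
    rewrite -[leLHS]ger0_norm; last by clear; lra.
    by rewrite -sqrtr_sqr ler_sqrt; clear; lra.
  by clear -h eps0; lra.
apply: le_lt_trans h1 _; rewrite addrC -[ltRHS]addrA ltrD2l addrC.
by apply: le_lt_trans h2 _; rewrite ltrDl.
Qed.

End Growth.

(** * Counting generalized diagonals *)

Section Counting.
Variable R : realType.
Local Notation C := R[i].
Variables a b : R.
Hypothesis a0 : 0 < a.
Hypothesis b0 : 0 < b.
Hypothesis ab : a + b < pi.
Local Notation z := (phase a).
Local Notation w := (phase b).

(** Square root of the bound in [ae_align], which concerns squared moduli. *)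
Definition aligned_bound (m : nat) : R := (96%:R ^- m) ^+ (4 * (6 * m + 4)).

Lemma take_mkseq_nth (T : Type) (d : T) (v : seq T) m s : (s <= m)%N -> (s <= size v)%N ->
  take s (mkseq (nth d v) m) = take s v.
Proof.
move=> sm sv; apply: (@eq_from_nth _ d).
  by rewrite !size_take_min size_mkseq; lia.
move=> i; rewrite size_take_min size_mkseq => lt.
by rewrite !nth_take ?nth_mkseq //; lia.
Qed.

(** The three vertices are images under one isometry, [Phi] of the first j letters, so they span the
    same area as three vertices of the strip of the next m letters. *)
Lemma apex_aligned m st u j (r s t : nat) :
  (forall i : triple m, align i (a, b) = 0 \/
     (96%:R ^- m) ^+ (8 * (6 * m + 4)) <= nsq (align i (a, b))) ->
  (0 < j)%N -> (j <= r < j + m)%N -> (j <= s < j + m)%N -> (j <= t < j + m)%N ->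
  (r < size u)%N -> (s < size u)%N -> (t < size u)%N ->
  let D := det3 (apex (V z w st) u r) (apex (V z w st) u s) (apex (V z w st) u t) in
  D = 0 \/ aligned_bound m / 32 <= `|D|.
Proof.
move=> good j0 jr js jt ru su tu D.
have zJ := phaseJ a; have wJ := phaseJ b.
(* A word that ends inside the window is padded with [None]; the prefixes used stop before the
   padding. *)
pose U : m.-tuple (option bool) := [tuple of mkseq (nth None (drop j u)) m].
have om k : (j <= k < j + m)%N -> (k - j < m)%N by lia.
pose pk k (jk : (j <= k < j + m)%N) : pick m := (Ordinal (om k jk), nth None u k.-1).
have apE k (jk : (j <= k < j + m)%N) : (k < size u)%N ->
    apex (V z w st) u k = coord z w st (Phi z w (take j u) (corner U (pk k jk) (a, b))).
  move=> ku; rewrite /apex /V /corner /=.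
  rewrite take_mkseq_nth ?size_drop; [|lia|lia].
  rewrite -Phi_cat take_drop subnK; last by lia.
  by rewrite -[X in X ++ _](@take_takel _ j k) ?cat_take_drop //; lia.
have A0 := area_neq0 a0 b0 ab.
have A0' : 0 < `|area z w| by rewrite normr_gt0.
pose i : triple m := (U, pk r jr, pk s js, pk t jt).
pose X := cross (corner U (pk s js) (a, b) - corner U (pk r jr) (a, b))
    (corner U (pk t jt) (a, b) - corner U (pk r jr) (a, b)).
have nD : `|D| = `|X| / `|area z w|.
  by rewrite /D !apE // det3_coord // cross_Phi // normrM normfV normrM normrX normrN1 expr1n mul1r.
have e : nsq (align i (a, b)) = 4 * X ^+ 2 := nsq_align i (a, b).
have [al0|le] := good i; last rewrite e in le.
  left; apply/normr0_eq0; rewrite nD.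
  move: e; rewrite al0 /nsq /= expr0n addr0 => /esym/eqP.
  by rewrite mulf_eq0 pnatr_eq0 /= sqrf_eq0 => /eqP ->; rewrite normr0 mul0r.
right; rewrite nD ler_pdivlMr //.
have e0 : 0 <= aligned_bound m by rewrite exprn_ge0 // invr_ge0 exprn_ge0.
have h : aligned_bound m <= 2 * `|X|.
  rewrite -(@ler_pXn2r _ 2) ?nnegrE ?mulr_ge0 // exprMn real_normK ?num_real //.
  rewrite (_ : 2 ^+ 2 = 4); last by ring.
  by rewrite (_ : 8 = 4 * 2)%N // mulnAC exprM in le.
have := area_le zJ wJ => hA.
(* The 32 is the factor 2 of [h] times the bound 16 for the area. *)
apply: (@le_trans _ _ (aligned_bound m / 32 * 16)).
  by rewrite ler_wpM2l // divr_ge0.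
have -> : aligned_bound m / 32 * 16 = aligned_bound m / 2 by field.
by rewrite ler_pdivrMr // mulrC.
Qed.

(** The area gap costs 96^(24 m^2 + 16 m), and (m^3 + 1)^2 and the constant cost at most 96^m each;
    24 m^2 + 18 m is at most 41 m^2 once m is at least 2. *)
Lemma cell_small m : (2 <= m)%N -> 2 ^+ 17 / area z w ^+ 2 < m%:R ->
  16 * (((16 * (m ^ 3).+1)%:R / `|area z w|) ^+ 2 * (96 ^+ (41 * m ^ 2))^-1) < aligned_bound m / 32.
Proof.
move=> m2 big.
have A2 : 0 < area z w ^+ 2 by rewrite exprn_even_gt0 //= area_neq0.
pose e := (4 * (6 * m + 4))%N.
have -> : aligned_bound m = (96 ^+ (m * e))^-1 by rewrite /aligned_bound exprVn -exprM.
set Q := 96 ^+ (41 * m ^ 2).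
have Q0 : 0 < Q by rewrite exprn_gt0.
have E0 : 0 < 96 ^+ (m * e) :> R by rewrite exprn_gt0.
rewrite exprMn exprVn real_normK ?num_real // ltr_pdivlMr // -[ltRHS]mul1r ltr_pdivlMr //.
(* The constant 2^17 is 16 * 16^2 * 32. *)
have -> : 16 * ((16 * (m ^ 3).+1)%:R ^+ 2 / area z w ^+ 2 / Q) * 32 * 96 ^+ (m * e) =
   2 ^+ 17 / area z w ^+ 2 * ((m ^ 3).+1%:R ^+ 2 * 96 ^+ (m * e)) / Q.
  by rewrite natrM exprMn; field; rewrite gt_eqF // area_neq0.
rewrite ltr_pdivrMr // mul1r.
apply: (@lt_le_trans _ _ (m%:R * ((m ^ 3).+1%:R ^+ 2 * 96 ^+ (m * e)))).
  by rewrite ltr_pM2r // mulr_gt0 // exprn_gt0.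
rewrite /Q -!natrX -!natrM ler_nat.
have h1 : ((m ^ 3).+1 ^ 2 <= 64 ^ m)%N.
  by rewrite (_ : 64 = 8 ^ 2)%N // -expnM mulnC expnM leq_exp2r // cube_lt_exp.
have h2 : (m <= 96 ^ m)%N by apply/ltnW/ltn_expl.
apply: (@leq_trans (96 ^ m * (96 ^ m * 96 ^ (m * e)))).
  apply: leq_mul => //; apply: leq_mul => //; apply: leq_trans h1 _.
  by rewrite leq_exp2r //; lia.
rewrite -!expnD leq_exp2l //; rewrite /e; nia.
Qed.

(** Diagonals are split by starting vertex, length, cell of the initial direction and word, in the
    order of the factors of [diag_bound]. *)
Lemma count_diags : (exists m0, forall m, (m0 <= m)%N -> forall i : triple m, align i (a, b) = 0 \/
     (96%:R ^- m) ^+ (8 * (6 * m + 4)) <= nsq (align i (a, b))) ->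
  exists m1, forall m, (m1 <= m)%N ->
    at_most (fun s : seq (R * R) => gen_diag a b s /\ (diag_length s <= m ^ 3)%N) (diag_bound m).
Proof.
move=> [m0 good].
have A0 := area_neq0 a0 b0 ab.
pose c := 2 ^+ 17 / area z w ^+ 2.
exists (maxn m0 (maxn 2 (Num.trunc c).+1)) => m; rewrite !geq_max => /and3P[lm0 lm2 lmc].
have big : c < m%:R.
  have /truncn_itv/andP[_ h] : 0 <= c by apply: divr_ge0; [rewrite exprn_ge0 | rewrite sqr_ge0].
  by apply: lt_le_trans h _; rewrite ler_nat.
have small := cell_small lm2 big.
have gm := good m lm0.
have ex s : exists d : option bool * seq (option bool) * R * (nat -> R),
    gen_diag a b s -> unfolds a b s d.1.1.1 d.1.1.2 d.1.2 d.2.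
  have [g|ng] := pselect (gen_diag a b s).
    by have [st [u [x [p h]]]] := gen_diag_unfolds a0 b0 ab g; exists (st, u, x, p).
  by exists (None, [::], 0, fun=> 0).
have [d dP] := boolp.choice ex.
pose st s := (d s).1.1.1; pose u s := (d s).1.1.2; pose x s := (d s).1.2; pose p s := (d s).2.
pose Q : nat := (96 ^ (41 * m ^ 2))%N.
have Q0 : 0 < Q%:R :> R by rewrite ltr0n expn_gt0.
(* The slope in (0, 1) falls into one of Q cells of width 1/Q, the angular width for which
   [cell_small] holds. *)
pose cell s := Num.trunc (x s * Q%:R).
have xP s : gen_diag a b s -> 0 < x s /\ x s < 1 by move=> /dP[[]].
have szu s : gen_diag a b s -> size (u s) = diag_length s.
  by move=> /dP[_ sz _ _ _]; rewrite /diag_length sz /= subn2.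
have cellP s : gen_diag a b s -> (cell s)%:R <= x s * Q%:R < (cell s).+1%:R.
  by move=> /xP[x0 _]; apply: truncn_itv; rewrite mulr_ge0 // ltW.
apply: (at_most_fibers (g := st)).
  apply: (at_most_leq _ (at_most_seq (r := [:: None; Some true; Some false]) _)) => //.
  by move=> [[]|].
move=> v; apply: (at_most_fibers (g := fun s => size (u s))).
  apply: (at_most_leq _ (at_most_seq (r := iota 0 (m ^ 3).+1) _)); first by rewrite size_iota.
  by move=> y [s [[g len] _] <-]; rewrite mem_iota /= add0n ltnS szu.
move=> l; apply: (at_most_fibers (g := cell)).
  apply: (at_most_leq _ (at_most_seq (r := iota 0 Q) _)); first by rewrite size_iota.
  move=> y [s [[[g len] _] _] <-]; rewrite mem_iota /= add0n.
  have /andP[h _] := cellP s g; have [_ x1] := xP s g.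
  by rewrite -(ltr_nat R); apply: le_lt_trans h _; rewrite -[ltRHS]mul1r ltr_pM2r.
(* Starting vertex and word determine the diagonal, so the fibres over words contribute the factor
   1. *)
move=> q; rewrite -[X in at_most _ X]muln1; apply: (at_most_fibers (g := u)); last first.
  move=> y; apply: at_most1 => s s' [[[[[g _] e1] _] _] e2] [[[[[g' _] e1'] _] _] e2'].
  have h := dP s g; have h' := dP s' g'.
  rewrite -/(st s) -/(u s) e1 e2 in h; rewrite -/(st s') -/(u s') e1' e2' in h'.
  exact: (unfolds_unique a0 b0 ab h h').
have [l0|l0] := posnP l.
  move=> ys uys ysP; case: ys uys ysP => [//|y ys] _ ysP.
  have [|s [[[[g _] _] sl] _] _] := ysP y; first by rewrite inE eqxx.
  by have [_ _ pos _ _] := dP s g; move: pos; rewrite -/(u s) sl l0.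
have [ll|ll] := leqP l (m ^ 3); last first.
  move=> ys uys ysP; case: ys uys ysP => [//|y ys] _ ysP.
  have [|s [[[[g len] _] sl] _] _] := ysP y; first by rewrite inE eqxx.
  by move: ll; rewrite -sl szu // ltnNge len.
have e1 : aligned_bound m / 32 <= 1.
  have h : aligned_bound m <= 1.
    apply: exprn_ile1; first by rewrite invr_ge0 exprn_ge0.
    by rewrite invf_le1 ?exprn_gt0 // exprn_ege1 // ler1n.
  by rewrite ler_pdivrMr // mul1r (le_trans h) // ler1n.
have Vs t o i : i != o -> V z w v (rcons t o) i = V z w v t i.
  by apply: V_step; apply: phaseJ.
have Vb i : i != v -> V z w v [::] i = (1, 0) \/ V z w v [::] i = (1, 1).
  by apply: V_base.
(* At most m^3 letters fit into the first letter followed by m^2 blocks of m. *)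
apply: (@word_count R (V z w v) v Vs Vb _ _ _ small e1 _ u x p _ l m (m ^ 2)) => //.
- move=> s [[[[g len] sv] sl] _]; split=> //.
  by have [r _ _ _ _] := dP s g; rewrite -sv.
- move=> s [[[[g len] sv] sl] _]; apply: tame_V => //; [exact: phaseJ|exact: phaseJ|].
  by rewrite szu.
- move=> s s' [[[[g len] sv] sl] cs] [[[[g' len'] sv'] sl'] cs'].
  have /andP[h1 h2] := cellP s g; have /andP[h1' h2'] := cellP s' g'.
  rewrite cs in h1 h2; rewrite cs' in h1' h2'; rewrite -natr1 in h2 h2'.
  rewrite -natrX -/Q -[_^-1]mul1r ler_pdivlMr // -[X in _ * X]ger0_norm ?(ltW Q0) // -normrM mulrBl.
  by rewrite ler_norml; apply/andP; split; lra.
- move=> s [[[[g len] sv] sl] cs] j r1 r2 r3 j0 h1 h2 h3 k1 k2 k3.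
  by apply: (apex_aligned v gm j0 h1 h2 h3); rewrite sl.
by rewrite (_ : 1 + m * m ^ 2 = (m ^ 3).+1)%N ?leqW // add1n -expnS.
Qed.

End Counting.

Theorem theorem4p4 (R : realType) :
  {ae ((@lebesgue_measure R) \x (@lebesgue_measure R))%E,
    forall ab : R * R,
      0 < ab.1 -> 0 < ab.2 -> ab.1 + ab.2 < pi ->
      forall eps : R, 0 < eps ->
      exists C : R, 0 < C /\
        forall n : nat, (1 <= n)%N ->
        forall s : seq (seq (R * R)), uniq s ->
          (forall d, d \in s -> gen_diag ab.1 ab.2 d /\ (diag_length d <= n)%N) ->
          (size s)%:R < C * expR (n%:R `^ (Num.sqrt 3 - 1 + eps))}.
Proof.
apply: ae_impl (@ae_align R) => -[a b] good /= a0 b0 ab eps eps0.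
have [m1 count] := count_diags a0 b0 ab good.
have [C [C0 grow]] := growth m1 eps0.
exists C; split=> // n n1 s us sP.
have [m [m1m nm lt]] := grow n n1.
apply: le_lt_trans lt; rewrite ler_nat; apply: (count m m1m s us) => d /sP[g len].
by split=> //; apply: leq_trans len nm.
Qed.
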